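(* There exist timelike minimal surfaces (with singular points) in a Lorentzian Heisenberg group $(\mathrm{Nil}_3(\tau),g_+)$, $\tau\neq0$, that have cuspidal edges, swallowtails, or cuspidal cross caps. That is: for each of the three singularity types $X$ (cuspidal edge, swallowtail, cuspidal cross cap) there exist a constant $\tau\in\mathbb{R}\setminus\{0\}$, a simply connected domain $D\subset\mathbb{C}'$, a Lorentzian harmonic map $g\colon D\to\mathbb{C}'\setminus\{w: |w|^2=-1\}$ and a point $p\in D$ such that the timelike minimal surface $f\colon D\to(\mathrm{Nil}_3(\tau),g_+)$ determined by $g$ is $\mathcal{A}$-equivalent to $X$ at $p$.
   Context: Paracomplex numbers: $\mathbb{C}'=\{z=x+jy : x,y\in\mathbb{R}\}$ with $j^2=1$; $\mathrm{Re}\,z=x$, $\bar z=x-jy$, $|z|^2=z\bar z=x^2-y^2$ (which may be zero or negative). On a domain $D\subset\mathbb{C}'\cong\mathbb{R}^2$ put $\partial_z=\frac12(\partial_x+j\partial_y)$, $\partial_{\bar z}=\frac12(\partial_x-j\partial_y)$; subscripts $z,\bar z$ denote these derivatives, and $\bar g_z$ means $(\bar g)_z$. All maps are smooth. Heisenberg group: for $\tau\in\mathbb{R}\setminus\{0\}$, $\mathrm{Nil}_3(\tau)$ is $\mathbb{R}^3$ with multiplication $(x^1,x^2,x^3)\cdot(y^1,y^2,y^3)=(x^1+y^1,\,x^2+y^2,\,x^3+y^3+\tau(x^1y^2-x^2y^1))$, equipped with the left invariant Lorentzian metric $g_+=-dx^1\otimes dx^1+dx^2\otimes dx^2+\eta\otimes\eta$,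 $\eta=dx^3+\tau(x^2dx^1-x^1dx^2)$. Timelike minimal surfaces with singular points: a smooth map $g\colon D\to\mathbb{C}'\setminus\{w: |w|^2=-1\}$ is Lorentzian harmonic (into the de Sitter sphere $\mathbb{S}^2_1$, in stereographic coordinate) if $g_{z\bar z}-\frac{2\bar g}{1+|g|^2}g_zg_{\bar z}=0$. Put $\hat\omega=-j\bar g_z/(1+|g|^2)^2$ and $\omega=\hat\omega\,dz$. For $D$ simply connected, the timelike minimal surface (possibly with singular points) determined by $g$ is $f={}^t(f^1,f^2,f^3)\colon D\to\mathrm{Nil}_3(\tau)$, $f^1=\frac2\tau\mathrm{Re}\int^z(g^2+1)\omega$, $f^2=\frac2\tau\mathrm{Re}\int^zj(g^2-1)\omega$, $f^3=\frac2\tau\mathrm{Re}\int^z\left(2g-\tau f^2(g^2+1)+\tau f^1j(g^2-1)\right)\omega$; it is timelike with zero mean curvature with respect to $g_+$ at its regular points. A singular point is a point where $df$ is not injective. Two smooth map germs $f_k\colon(D_k,p_k)\to(N^3,f_k(p_k))$, $k=1,2$, with $D_k\subset\mathbb{R}^2$, are $\mathcal{A}$-equivalent if $f_2=\Psi\circ f_1\circ\Phi^{-1}$ for diffeomorphism germs $\Phi$ of source and $\Psi$ of target. ''$f$ is $\mathcal{A}$-equivalent to the cuspidal edge / swallowtail / cuspidal cross cap at $p$'' means that the germ of $f$ at $p$ is $\mathcal{A}$-equivalent to the germ at the origin of, respectively, $(x,y)\mapsto(x,y^2,y^3)$, $(x,y)\mapsto(3x^4+x^2y,\,4x^3+2xy,\,y)$,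 $(x,y)\mapsto(x,y^2,xy^3)$. *)

(* Defs.v *)
From mathcomp Require Export all_boot all_order all_algebra.
From mathcomp Require Export all_classical all_reals all_analysis.
Export numFieldNormedType.Exports.

Set Implicit Arguments.
Unset Strict Implicit.
Unset Printing Implicit Defensive.
Import Order.TTheory GRing.Theory Num.Theory.
Local Open Scope classical_set_scope.
Local Open Scope ring_scope.

(* [C^k] and smooth maps on an open set of a finite-dimensional space. *)
Fixpoint class_C {R : realType} {V W : normedModType R} (k : nat)
    (U : set V) (f : V -> W) : Prop :=
  match k with
  | 0 => forall x, U x -> {for x, continuous f}
  | k'.+1 => (forall x, U x -> differentiable f x) /\
             (forall v : V, class_C k' U ('D_v f))
  end.

Definition smooth_on {R : realType} {V W : normedModType R}
  (U : set V) (f : V -> W) : Prop := forall k, class_C k U f.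

(* [(x, y)] stands for [x + j y].  The plane keeps its product topology and
   product vector space structure, but not the componentwise product that
   MathComp puts on pairs: the product of paracomplex numbers is [pcmul]. *)
Notation paracomplex R := (R * R)%type (only parsing).

Section Paracomplex.
Context {R : realType}.
Implicit Types z w : paracomplex R.

Definition pcone : paracomplex R := (1, 0).
Definition pcj : paracomplex R := (0, 1).
Definition pcre z : R := z.1.
Definition pcmul z w : paracomplex R :=
  (z.1 * w.1 + z.2 * w.2, z.1 * w.2 + z.2 * w.1).
Definition pcconj z : paracomplex R := (z.1, - z.2).
Definition pcsq z : paracomplex R := pcmul z z.

(* [|z|^2 = z * conj z], which is real and may be zero or negative *)
Definition pcnormsq z : R := pcre (pcmul z (pcconj z)).

Definition d_z (g : paracomplex R -> paracomplex R) z : paracomplex R :=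
  2^-1 *: ('D_((1, 0) : R * R) g z + pcmul pcj ('D_((0, 1) : R * R) g z)).
Definition d_zbar (g : paracomplex R -> paracomplex R) z : paracomplex R :=
  2^-1 *: ('D_((1, 0) : R * R) g z - pcmul pcj ('D_((0, 1) : R * R) g z)).

End Paracomplex.

Section Domains.
Context {R : realType}.
Implicit Type D : set (paracomplex R).

Definition domain D : Prop := [/\ open D, connected D & D !=set0].

(* path-connected, and every loop is null-homotopic relative to its base point *)
Definition simply_connected D : Prop :=
  (forall a b, D a -> D b -> exists gamma : R -> paracomplex R,
     [/\ {within `[0, 1], continuous gamma},
         (forall t : R, t \in `[0, 1] -> D (gamma t)),
         gamma 0 = a & gamma 1 = b]) /\
  (forall gamma : R -> paracomplex R,
     {within `[0, 1], continuous gamma} ->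
     (forall t : R, t \in `[0, 1] -> D (gamma t)) ->
     gamma 0 = gamma 1 ->
     exists H : R * R -> paracomplex R,
       [/\ {within `[0, 1] `*` `[0, 1], continuous H},
           (forall s t : R, s \in `[0, 1] -> t \in `[0, 1] -> D (H (s, t))),
           (forall t : R, t \in `[0, 1] -> H (0, t) = gamma t),
           (forall t : R, t \in `[0, 1] -> H (1, t) = gamma 0) &
           (forall s : R, s \in `[0, 1] ->
              H (s, 0) = gamma 0 /\ H (s, 1) = gamma 0)]).

Definition C1_arc D (gamma : R -> paracomplex R) : Prop :=
  [/\ (forall t : R, t \in `[0, 1] -> derivable gamma t 1),
      {within `[0, 1], continuous derive1 gamma} &
      (forall t : R, t \in `[0, 1] -> D (gamma t))].

(* [F = Re \int^z phi dz] on [D]: the increment of [F] along any arc of [D] is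
   the real part of the line integral of [phi dz].  As for any integral with
   unspecified base point, [F] is determined up to an additive constant. *)
Definition re_integral D (phi : paracomplex R -> paracomplex R)
    (F : paracomplex R -> R) : Prop :=
  forall gamma, C1_arc D gamma ->
    F (gamma 1) - F (gamma 0) =
    \int[lebesgue_measure]_(t in `[0, 1])
      pcre (pcmul (phi (gamma t)) (derive1 gamma t)).

End Domains.

Section Surfaces.
Context {R : realType}.
Implicit Types (D : set (paracomplex R)) (g : paracomplex R -> paracomplex R).

Definition lorentz_harmonic D g : Prop :=
  [/\ smooth_on D g,
      (forall z, D z -> pcnormsq (g z) != -1) &
      (forall z, D z ->
         d_zbar (d_z g) z
         - (2 / (1 + pcnormsq (g z))) *:
             pcmul (pcconj (g z)) (pcmul (d_z g z) (d_zbar g z)) = 0)].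

(* the coefficient of [dz] in [omega] *)
Definition omega_hat g (z : paracomplex R) : paracomplex R :=
  ((1 + pcnormsq (g z)) ^+ 2)^-1 *:
    - pcmul pcj (d_z (fun w => pcconj (g w)) z).

(* [f] is the timelike minimal surface in [Nil_3(tau)] determined by [g];
   a point [((x1, x2), x3)] of [R * R * R] stands for [(x1, x2, x3)]. *)
Definition minimal_surface (tau : R) D g
    (f : paracomplex R -> R * R * R) : Prop :=
  let f1 z := (f z).1.1 in
  let f2 z := (f z).1.2 in
  let f3 z := (f z).2 in
  exists F1 F2 F3 : paracomplex R -> R,
    [/\ re_integral D
          (fun z => pcmul (pcsq (g z) + pcone) (omega_hat g z)) F1,
        re_integral D
          (fun z => pcmul (pcmul pcj (pcsq (g z) - pcone)) (omega_hat g z)) F2,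
        re_integral D
          (fun z => pcmul
             (2 *: g z - (tau * f2 z) *: (pcsq (g z) + pcone)
              + (tau * f1 z) *: pcmul pcj (pcsq (g z) - pcone))
             (omega_hat g z)) F3 &
        forall z, D z ->
          [/\ f1 z = 2 / tau * F1 z, f2 z = 2 / tau * F2 z &
              f3 z = 2 / tau * F3 z]].

End Surfaces.

Section Singularities.
Context {R : realType}.

(* [Phi] is a diffeomorphism germ [(V, p) -> (W, q)] with inverse [Phi']. *)
Definition diffeo_germ {V W : normedModType R} (Phi : V -> W) (Phi' : W -> V)
    (p : V) (q : W) : Prop :=
  Phi p = q /\
  exists (A : set V) (B : set W),
    [/\ open A /\ A p, open B /\ B q,
        smooth_on A Phi /\ smooth_on B Phi',
        (forall x, A x -> B (Phi x) /\ Phi' (Phi x) = x) &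
        (forall y, B y -> A (Phi' y) /\ Phi (Phi' y) = y)].

Definition A_equivalent (f1 : R * R -> R * R * R) (p1 : R * R)
    (f2 : R * R -> R * R * R) (p2 : R * R) : Prop :=
  exists (Phi Phi' : R * R -> R * R) (Psi Psi' : R * R * R -> R * R * R),
    [/\ diffeo_germ Phi Phi' p1 p2,
        diffeo_germ Psi Psi' (f1 p1) (f2 p2) &
        \forall x \near p2, f2 x = Psi (f1 (Phi' x))].

Definition cuspidal_edge (p : R * R) : R * R * R :=
  let: (x, y) := p in (x, y ^+ 2, y ^+ 3).

Definition swallowtail (p : R * R) : R * R * R :=
  let: (x, y) := p in
  (3 * x ^+ 4 + x ^+ 2 * y, 4 * x ^+ 3 + 2 * x * y, y).

Definition cuspidal_cross_cap (p : R * R) : R * R * R :=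
  let: (x, y) := p in (x, y ^+ 2, x * y ^+ 3).

End Singularities.

(* Main.v *)
Require Import Defs.
From mathcomp Require Import ring lra.
Set Implicit Arguments.
Unset Strict Implicit.
Unset Printing Implicit Defensive.
Import Order.TTheory GRing.Theory Num.Theory.
Local Open Scope classical_set_scope.
Local Open Scope ring_scope.

(** Paracomplex numbers split: writing [u = x + y] and [v = x - y] for the null
coordinates of [x + j y], multiplication is componentwise, [d_z] acts as
[(d/du, d/dv)] and [d_zbar] as [(d/dv, d/du)].  For a map [g] with null
components [(a, b)] harmonicity becomes the pair of equations

  [a_uv = 2 b a_u a_v / (1 + a b)],  [b_uv = 2 a b_u b_v / (1 + a b)].

The choice [b = - 1 / u] trivializes the second one, and after the substitution
[a = u + 1 / w] the first one holds as soon as [w] satisfies the Riccati equation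
[w_u = w^2 - H(u)] for some function [H], the coordinate [v] being the parameter
of a family of solutions.  With [tau = 2] and [K' = H], [L' = u^2 H],
[M' = H (u^2 K - u - L)], the three integrals can be computed in closed form:

  [f1 + f2 = - u - u^2 w - L],  [f1 - f2 = - w - K],
  [f3 = K (u + u^2 w) - L w + M].

These are affine functions of [w] for fixed [u]: the surface is ruled, and in
fact it is the tangent developable of a space curve, singular along
[1 + 2 u w = 0].  It depends on the single function [H], and the three
singularity types are obtained at the point [u = 1], [v = 0], [w = - 1/2] for
three functions [H] chosen so that the normal form can be reached by explicit
changes of coordinates.

For [H = - 1/2] the surface is, up to a polynomial change of coordinates in the
target, the discriminant of the quartics [x^4 + y x^2 - b x + c], that is a
swallowtail.

For [H = - 1 / (2 u^2) + 2 k u] and fixed [q = f1 - f2], the function [f1 + f2]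
equals [q u^2 + k u^4 / 2].  Being quadratic in [u^2] it folds the surface along
the explicit involution [u -> u'] with [u^2 + u'^2 = - 2 q / k].  In the
coordinates [E = u + u'], [D = u - u'] the surface is polynomial, [f1] and [f2]
are even in [D], and the odd part of [f3] is [(k / 12) (1 - k E^3 / 2) D^3].  At
the base point [E = 2], so the factor [1 - 4 k] decides: it is nonzero for
[k = 1/2], which gives a cuspidal edge, and it has a simple zero in [E] for
[k = 1/4], which gives a cuspidal cross cap ([folded_A_equivalent]).

The Riccati equation is linearized by [w = X / Y] with [Y' = - X] and
[X' = - H Y].  It is solved by sines and cosines when [H] is constant, and by a
power series in [u^3 - 1] with bounded coefficients in the other case
([cusp_system]).  [realization] then turns a normal form of the ruled map in the
coordinates [(u, w)] into a timelike minimal surface over a small ball. *)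

(** * Calculus of [C^k] maps *)

Section ClassC.
Context {R : realType} {V : normedModType R}.

Lemma near_eq_differentiable (W : normedModType R) (f g : V -> W) x :
  (\near x, f x = g x) -> differentiable f x -> differentiable g x.
Proof.
move=> fg df; rewrite -[g](subrKC f).
apply: differentiableD => //.
have e0 : (g - f) \o shift x = cst ((g - f) x) + (\0 : {linear V -> W}) +o_ 0 id.
  apply/eqaddoP => _/posnumP[eps]; near=> h.
  rewrite !fctE /= (nbhs_singleton fg) subrr addr0 subr0.
  suff -> : f (h + x) = g (h + x) by rewrite subrr normr0 mulr_ge0.
  near: h; move: fg; rewrite (near_shift 0); apply: filterS => y /=.
  by rewrite subr0.
have c0 : continuous (\0 : {linear V -> W}) by exact: cst_continuous.
by apply/diff_locallyP; rewrite (diff_unique c0 e0).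
Unshelve. all: by end_near. Qed.

Lemma class_C_sub (W : normedModType R) k (U U' : set V) (f : V -> W) :
  U `<=` U' -> class_C k U' f -> class_C k U f.
Proof.
move=> UU'; elim: k f => [|k IH] f /=; first by move=> h x /UU'; exact: h.
by move=> [df h]; split=> [x /UU' /df//|v]; exact: IH.
Qed.

Lemma class_CS (W : normedModType R) k (U : set V) (f : V -> W) :
  class_C k.+1 U f -> class_C k U f.
Proof.
elim: k f => [|k IH] f /= [df h].
  by move=> x Ux; exact/differentiable_continuous/df.
by split=> // v; apply: IH; exact: h.
Qed.

Lemma class_C_ext (W : normedModType R) k (U : set V) (f g : V -> W) :
  open U -> (forall x, U x -> f x = g x) -> class_C k U f -> class_C k U g.
Proof.
move=> oU; elim: k f g => [|k IH] f g fg /=.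
  move=> cf x Ux; rewrite /prop_for /continuous_at -(fg x Ux).
  apply: cvg_trans (cf x Ux); apply: near_eq_cvg.
  by near do apply: fg; exact: open_nbhs_nbhs.
have nfg x : U x -> \near x, f x = g x.
  by move=> Ux; near do apply: fg; exact: open_nbhs_nbhs.
move=> [df h]; split=> [x Ux|v].
  exact: near_eq_differentiable (nfg x Ux) (df x Ux).
apply: (IH ('D_v f)) => // x Ux; apply: near_eq_derive; exact: nfg.
Unshelve. all: by end_near. Qed.

Lemma class_C_cst (W : normedModType R) k (U : set V) (a : W) :
  class_C k U (fun=> a).
Proof.
elim: k a => [|k IH] a /=; first by move=> x _; exact: cst_continuous.
split=> [x _|v]; first exact: differentiable_cst.
by rewrite (_ : 'D_v _ = fun=> 0)//; apply/funext => x; exact: derive_cst.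
Qed.

Lemma class_C_linear (W : normedModType R) k (U : set V) (l : {linear V -> W}) :
  continuous l -> class_C k U l.
Proof.
move=> cl; case: k => [|k] /=; first by move=> x _; exact: cl.
split=> [x _|v]; first exact: linear_differentiable.
rewrite (_ : 'D_v _ = fun=> l v); first exact: class_C_cst.
by apply/funext => x; rewrite deriveE ?diff_lin//; exact: linear_differentiable.
Qed.

Lemma class_C_linear_comp (W W' : normedModType R) k (U : set V)
    (l : {linear W -> W'}) (f : V -> W) : open U ->
  continuous l -> class_C k U f -> class_C k U (l \o f).
Proof.
move=> oU cl; elim: k f => [|k IH] f /=.
  by move=> cf x Ux; apply: continuous_comp; [exact: cf|exact: cl].
have dl y : differentiable l y by exact: linear_differentiable.
move=> [df cf]; split=> [x Ux|v].
  by apply: differentiable_comp => //; exact: df.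
apply: (class_C_ext oU _ (IH _ (cf v))) => x Ux.
have dfx := df x Ux.
by rewrite /= (deriveE v (differentiable_comp dfx (dl _))) diff_comp//= diff_lin// -deriveE.
Qed.

Lemma class_C_pair (W W' : normedModType R) k (U : set V) (f : V -> W)
    (g : V -> W') : open U ->
  class_C k U f -> class_C k U g -> class_C k U (fun x => (f x, g x)).
Proof.
move=> oU; elim: k f g => [|k IH] f g /=.
  by move=> cf cg x Ux; apply: cvg_pair; [exact: cf|exact: cg].
move=> [df cf] [dg cg]; split=> [x Ux|v].
  by apply: differentiable_pair; [exact: df|exact: dg].
apply: (class_C_ext oU _ (IH _ _ (cf v) (cg v))) => x Ux.
by rewrite !deriveE; [rewrite diff_pair|..]; auto; apply: differentiable_pair; auto.
Qed.

Lemma class_CD (W : normedModType R) k (U : set V) (f g : V -> W) : open U ->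
  class_C k U f -> class_C k U g -> class_C k U (f \+ g).
Proof.
move=> oU; elim: k f g => [|k IH] f g /=.
  by move=> cf cg x Ux; apply: cvgD; [exact: cf|exact: cg].
move=> [df cf] [dg cg]; split=> [x Ux|v].
  by apply: differentiableD; [exact: df|exact: dg].
apply: (class_C_ext oU _ (IH _ _ (cf v) (cg v))) => x Ux.
by apply/esym/deriveD; apply: diff_derivable; auto.
Qed.

Lemma class_CM k (U : set V) (f g : V -> R) : open U ->
  class_C k U f -> class_C k U g -> class_C k U (f \* g).
Proof.
move=> oU; elim: k f g => [|k IH] f g.
  by move=> /= cf cg x Ux; apply: cvgM; [exact: cf|exact: cg].
move=> Cf Cg; have [df cf] := Cf; have [dg cg] := Cg; split=> [x Ux|v].
  by apply: differentiableM; [exact: df|exact: dg].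
have h := class_CD oU (IH _ _ (class_CS Cf) (cg v)) (IH _ _ (class_CS Cg) (cf v)).
apply: (class_C_ext oU _ h) => x Ux.
by rewrite [RHS]deriveM//; apply: diff_derivable; auto.
Qed.

(** Composition is only treated for inner maps into [R] and [R * R], where the
derivative of the outer map in a varying direction is a combination of its
partial derivatives with [C^k] coefficients. *)
Lemma class_C_comp1 k (U : set V) (I : set R) (h : R -> R) (f : V -> R) :
  open U -> (forall x, U x -> I (f x)) ->
  class_C k I h -> class_C k U f -> class_C k U (h \o f).
Proof.
move=> oU UI; elim: k h => [|k IH] h.
  by move=> /= ch cf x Ux; apply: continuous_comp; [exact: cf|apply: ch; auto].
move=> [dh ch] Cf; have [df cf] := Cf; split=> [x Ux|v].
  by apply: differentiable_comp; auto.
have := class_CM oU (cf v) (IH _ (ch 1) (class_CS Cf)).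
apply: class_C_ext => // x Ux.
have dhf := dh _ (UI x Ux); have dfx := df x Ux.
have -> : 'D_v (h \o f) x = 'd h (f x) ('D_v f x).
  by rewrite (deriveE v (differentiable_comp dfx dhf)) diff_comp// (deriveE v dfx).
have -> : 'd h (f x) ('D_v f x) = 'D_v f x *: 'd h (f x) 1.
  by rewrite -linearZ /= [_ *: 1]mulr1.
by rewrite -deriveE.
Qed.

Lemma class_C_comp2 k (U : set V) (I : set (R * R)) (h : R * R -> R)
    (f g : V -> R) :
  open U -> (forall x, U x -> I (f x, g x)) ->
  class_C k I h -> class_C k U f -> class_C k U g ->
  class_C k U (fun x => h (f x, g x)).
Proof.
move=> oU UI; elim: k h => [|k IH] h.
  move=> ch cf cg x Ux.
  apply: (@continuous_comp _ _ _ (fun x => (f x, g x)) h x); last exact: ch (UI x Ux).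
  exact: (class_C_pair (k := 0) oU cf cg) Ux.
move=> [dh ch] Cf Cg; have [df cf] := Cf; have [dg cg] := Cg.
have dfg x : U x -> differentiable (fun x => (f x, g x)) x.
  by move=> Ux; apply: differentiable_pair; auto.
split=> [x Ux|v].
  by apply: (differentiable_comp (f := fun x => (f x, g x))); auto.
have H1 := class_CM oU (cf v) (IH _ (ch (1, 0)) (class_CS Cf) (class_CS Cg)).
have H2 := class_CM oU (cg v) (IH _ (ch (0, 1)) (class_CS Cf) (class_CS Cg)).
apply: class_C_ext (class_CD oU H1 H2) => // x Ux /=.
have dhfg := dh _ (UI x Ux); have dfx := df x Ux; have dgx := dg x Ux.
have -> : 'D_v (fun x => h (f x, g x)) x = 'd h (f x, g x) ('D_v f x, 'D_v g x).
  rewrite (deriveE v (differentiable_comp (dfg x Ux) dhfg)) diff_comp//; last exact: dfg.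
  by rewrite /= diff_pair// (deriveE v dfx) (deriveE v dgx).
have -> : ('D_v f x, 'D_v g x) = 'D_v f x *: (1, 0) + 'D_v g x *: (0, 1) :> R * R.
  by congr (_, _); rewrite /= !scaler0 ?addr0 ?add0r [_ *: _]mulr1.
by rewrite linearD !linearZ /= -(deriveE _ dhfg) -(deriveE _ dhfg).
Qed.

End ClassC.

(** * Germs of smooth maps *)

Section SmoothReal.
Context {R : realType}.

(** In one variable the derivative in any direction is a multiple of the usual
derivative, so that functions satisfying a differential equation gain one order
of regularity at a time. *)
Lemma class_C_derive1 k (U : set R) (h dh : R -> R) : open U ->
  (forall x, U x -> is_derive x 1 h (dh x)) ->
  class_C k U dh -> class_C k.+1 U h.
Proof.
move=> oU hdh cdh; split=> [x Ux|v].
  by apply/derivable1_diffP; case: (hdh x Ux).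
apply: (class_C_ext oU _ (class_CM oU (class_C_cst k U v) cdh)) => x Ux /=.
have [/derivable1_diffP dh1 <-] := hdh x Ux.
by rewrite !(deriveE _ dh1) -[RHS](congr1 _ (mulr1 v)) -[v * 1]/(v *: 1) linearZ.
Qed.

Lemma smooth_on_inv : smooth_on [set x : R | x != 0] GRing.inv.
Proof.
have o0 : open [set x : R | x != 0] by apply: open_neq.
elim=> [x x0|k IH]; first exact: inv_continuous.
apply: (@class_C_derive1 _ _ _ (fun x => (-1) * (x^-1 * x^-1))) => // [x x0|].
  apply: DeriveDef; first exact/diff_derivable/differentiable_Rinv.
  rewrite (deriveE _ (differentiable_Rinv x0)) diff_Rinv//.
  by rewrite mulN1r [LHS]mulr1 -expr2 exprVn.
by apply: class_CM => //; [exact: class_C_cst|exact: class_CM].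
Qed.

Lemma smooth_on_powR (a : R) : smooth_on [set x : R | 0 < x] (fun x => x `^ a).
Proof.
move=> k; elim: k a => [|k IH] a.
  move=> x x0; apply/differentiable_continuous/derivable1_diffP.
  by have [] := @is_derive1_powR R a x x0.
have o0 : open [set x : R | 0 < x] by exact: open_gt.
apply: (@class_C_derive1 k _ _ (fun x => a * x `^ (a - 1))) => //.
by apply: class_CM => //; exact: class_C_cst.
Qed.

End SmoothReal.

(** Working with germs keeps the domains out of the way: nonvanishing and
positivity are only asked at the point, and the neighbourhood shrinks silently. *)
Definition smooth_at {R : realType} {V W : normedModType R} (p : V) (f : V -> W) :=
  exists U, [/\ open U, U p & smooth_on U f].

Section SmoothAt.
Context {R : realType} {V : normedModType R} {p : V}.
Implicit Types (f g : V -> R).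

Lemma smooth_at_near_eq (W : normedModType R) (f g : V -> W) :
  (\near p, f p = g p) -> smooth_at p f -> smooth_at p g.
Proof.
move=> fg [U [oU Up sf]]; exists (U `&` [set x | f x = g x]°).
split.
- exact/openI/open_interior.
- by [].
move=> k; apply: (class_C_ext (f := f)); first exact/openI/open_interior.
  by move=> x [_ /interior_subset].
by apply: class_C_sub (sf k) => x [].
Qed.

Lemma smooth_at_near (W : normedModType R) (f : V -> W) :
  smooth_at p f -> \forall q \near p, smooth_at q f.
Proof.
move=> [U [oU Up sf]]; near=> q; exists U; split=> //.
by near: q; exact: open_nbhs_nbhs.
Unshelve. all: by end_near. Qed.

Lemma smooth_at_continuous (W : normedModType R) (f : V -> W) :
  smooth_at p f -> {for p, continuous f}.
Proof. by move=> [U [oU Up /(_ 0%N)]]; exact. Qed.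

Lemma smooth_at_differentiable (W : normedModType R) (f : V -> W) :
  smooth_at p f -> differentiable f p.
Proof. by move=> [U [oU Up /(_ 1%N) []]] => + _; exact. Qed.

Lemma smooth_at_cst (W : normedModType R) (a : W) : smooth_at p (fun=> a).
Proof. by exists setT; split=> //[|k]; [exact: openT|exact: class_C_cst]. Qed.

Lemma smooth_at_linear (W : normedModType R) (l : {linear V -> W}) :
  continuous l -> smooth_at p l.
Proof. by exists setT; split=> //[|k]; [exact: openT|exact: class_C_linear]. Qed.

Lemma smooth_at_pair (W W' : normedModType R) (f : V -> W) (g : V -> W') :
  smooth_at p f -> smooth_at p g -> smooth_at p (fun x => (f x, g x)).
Proof.
move=> [U [oU Up sf]] [U' [oU' Up' sg]]; exists (U `&` U'); split=> //.
  exact: openI.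
by move=> k; apply: class_C_pair; [exact: openI|apply: class_C_sub (sf k) => x []|
  apply: class_C_sub (sg k) => x []].
Qed.

Lemma smooth_atD f g :
  smooth_at p f -> smooth_at p g -> smooth_at p (fun x => f x + g x).
Proof.
move=> [U [oU Up sf]] [U' [oU' Up' sg]]; exists (U `&` U'); split=> //.
  exact: openI.
by move=> k; apply: class_CD; [exact: openI|apply: class_C_sub (sf k) => x []|
  apply: class_C_sub (sg k) => x []].
Qed.

Lemma smooth_atM f g :
  smooth_at p f -> smooth_at p g -> smooth_at p (fun x => f x * g x).
Proof.
move=> [U [oU Up sf]] [U' [oU' Up' sg]]; exists (U `&` U'); split=> //.
  exact: openI.
by move=> k; apply: class_CM; [exact: openI|apply: class_C_sub (sf k) => x []|
  apply: class_C_sub (sg k) => x []].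
Qed.

Lemma smooth_atN f : smooth_at p f -> smooth_at p (fun x => - f x).
Proof.
move=> sf; rewrite (_ : (fun x => - f x) = (fun x => -1 * f x)).
  exact/smooth_atM/sf/smooth_at_cst.
by apply/funext => x; rewrite mulN1r.
Qed.

Lemma smooth_atB f g :
  smooth_at p f -> smooth_at p g -> smooth_at p (fun x => f x - g x).
Proof. by move=> sf sg; exact/smooth_atD/smooth_atN. Qed.

Lemma smooth_atX f n : smooth_at p f -> smooth_at p (fun x => f x ^+ n).
Proof.
move=> sf; elim: n => [|n IH]; first exact: smooth_at_cst.
rewrite (_ : (fun x => f x ^+ n.+1) = (fun x => f x * f x ^+ n)).
  exact: smooth_atM.
by apply/funext => x; rewrite exprS.
Qed.

Lemma smooth_at_comp1 (h : R -> R) f :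
  smooth_at (f p) h -> smooth_at p f -> smooth_at p (fun x => h (f x)).
Proof.
move=> [I [oI Ip sh]] sf; have cf := smooth_at_continuous sf.
case: sf => U [oU Up sf].
exists (U `&` (f @^-1` I)°); split.
- exact/openI/open_interior.
- split=> //; apply: cf; exact: open_nbhs_nbhs.
move=> k; apply: (class_C_comp1 (I := I)) (sh k) _.
- exact/openI/open_interior.
- by move=> x [_ /interior_subset].
by apply: class_C_sub (sf k) => x [].
Qed.

Lemma smooth_at_comp2 (h : R * R -> R) f g :
  smooth_at (f p, g p) h -> smooth_at p f -> smooth_at p g ->
  smooth_at p (fun x => h (f x, g x)).
Proof.
move=> [I [oI Ip sh]] sf sg.
have cfg := smooth_at_continuous (smooth_at_pair sf sg).
case: (smooth_at_pair sf sg) => U [oU Up _].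
case: sf => U1 [oU1 Up1 sf]; case: sg => U2 [oU2 Up2 sg].
pose P := ((fun x => (f x, g x)) @^-1` I)°.
exists (U1 `&` U2 `&` P); split.
- by apply/openI/open_interior; exact: openI.
- split=> //; apply: cfg; exact: open_nbhs_nbhs.
move=> k; apply: (class_C_comp2 (I := I)) (sh k) _ _.
- by apply/openI/open_interior; exact: openI.
- by move=> x [_ /interior_subset].
- by apply: class_C_sub (sf k) => x [[]].
- by apply: class_C_sub (sg k) => x [[]].
Qed.

Lemma smooth_atV f : f p != 0 -> smooth_at p f -> smooth_at p (fun x => (f x)^-1).
Proof.
move=> fp; apply: smooth_at_comp1; exists [set x | x != 0]; split.
- exact: open_neq.
- exact: fp.
- exact: smooth_on_inv.
Qed.

Lemma smooth_at_powR f a : 0 < f p -> smooth_at p f ->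
  smooth_at p (fun x => f x `^ a).
Proof.
move=> fp; apply: (@smooth_at_comp1 (fun x => x `^ a)); exists [set x | 0 < x]; split.
- exact: open_gt.
- exact: fp.
- exact: smooth_on_powR.
Qed.

End SmoothAt.

Section Coordinates.
Context {R : realType}.

Lemma smooth_at_id (V : normedModType R) (p : V) : smooth_at p (fun x => x).
Proof. by apply: (smooth_at_linear (l := idfun)) => x; exact: cvg_id. Qed.

Lemma smooth_at_fst (V W W' : normedModType R) (p : V) (f : V -> W * W') :
  smooth_at p f -> smooth_at p (fun x => (f x).1).
Proof.
move=> [U [oU Up sf]]; exists U; split=> // k.
by apply: (class_C_linear_comp (l := fst)) (sf k) => // x; exact: cvg_fst.
Qed.

Lemma smooth_at_snd (V W W' : normedModType R) (p : V) (f : V -> W * W') :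
  smooth_at p f -> smooth_at p (fun x => (f x).2).
Proof.
move=> [U [oU Up sf]]; exists U; split=> // k.
by apply: (class_C_linear_comp (l := snd)) (sf k) => // x; exact: cvg_snd.
Qed.

End Coordinates.

(** * Diffeomorphism germs and A-equivalence *)

Section Germs.
Context {R : realType}.

Lemma open_setI_preimage (V W : topologicalType) (U : set V) (U' : set W)
    (f : V -> W) : open U -> (forall x, U x -> {for x, continuous f}) ->
  open U' -> open (U `&` f @^-1` U').
Proof.
move=> oU cf oU'; rewrite openE => x [Ux fx]; apply: filterI.
  exact: open_nbhs_nbhs.
by apply: cf => //; exact: open_nbhs_nbhs.
Qed.

(** It suffices that the two maps be inverse to each other near the base points:
the sets of the definition are obtained by cutting down twice. *)
Lemma diffeo_germ_near (V W : normedModType R) (Phi : V -> W) (Phi' : W -> V) p q :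
  smooth_at p Phi -> smooth_at q Phi' -> Phi p = q ->
  (\near p, Phi' (Phi p) = p) -> (\near q, Phi (Phi' q) = q) ->
  diffeo_germ Phi Phi' p q.
Proof.
move=> [U [oU Up sU]] [U' [oU' Uq' sU']] pq K K'; split=> //.
have pq' : Phi' q = p by rewrite -pq (nbhs_singleton K).
pose A := U `&` [set x | Phi' (Phi x) = x]°.
pose B := U' `&` [set y | Phi (Phi' y) = y]°.
have oA : open A by exact/openI/open_interior.
have oB : open B by exact/openI/open_interior.
have Ap : A p by split.
have Bq : B q by split.
have KA x : A x -> Phi' (Phi x) = x by move=> [_ /interior_subset].
have KB y : B y -> Phi (Phi' y) = y by move=> [_ /interior_subset].
exists (A `&` Phi @^-1` B), (B `&` Phi' @^-1` A); split.
- split; last by split=> //=; rewrite pq.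
  by apply: open_setI_preimage => // x [Ux _]; exact: (sU 0%N).
- split; last by split=> //=; rewrite pq'.
  by apply: open_setI_preimage => // x [Ux _]; exact: (sU' 0%N).
- by split=> k; [apply: class_C_sub (sU k)|apply: class_C_sub (sU' k)] => x [[]].
- by move=> x [Ax Bx]; split; [split=> //=; rewrite KA|exact: KA].
- by move=> y [By Ay]; split; [split=> //=; rewrite KB|exact: KB].
Qed.

Lemma diffeo_germP (V W : normedModType R) (Phi : V -> W) (Phi' : W -> V) p q :
  diffeo_germ Phi Phi' p q ->
  [/\ smooth_at p Phi, smooth_at q Phi', Phi' q = p,
      \near p, Phi' (Phi p) = p & \near q, Phi (Phi' q) = q].
Proof.
move=> [pq [A [B [[oA Ap] [oB Bq] [sA sB] KA KB]]]]; split.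
- by exists A.
- by exists B.
- by rewrite -pq; exact: (KA p Ap).2.
- by near=> x; apply: (KA x _).2; near: x; exact: open_nbhs_nbhs.
- by near=> x; apply: (KB x _).2; near: x; exact: open_nbhs_nbhs.
Unshelve. all: by end_near. Qed.

Lemma smooth_at_comp (V : normedModType R) (p : V) (f : V -> R * R)
    (h : R * R -> R * R) :
  smooth_at (f p) h -> smooth_at p f -> smooth_at p (h \o f).
Proof.
move=> sh sf; have sh1 := smooth_at_fst sh; have sh2 := smooth_at_snd sh.
have sf1 := smooth_at_fst sf; have sf2 := smooth_at_snd sf.
rewrite [f p]surjective_pairing in sh1 sh2.
pose c (k : R * R -> R) := @smooth_at_comp2 R V p k (fun x => (f x).1) (fun x => (f x).2).
have := smooth_at_pair (c _ sh1 sf1 sf2) (c _ sh2 sf1 sf2).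
apply: smooth_at_near_eq; apply: nearW => x.
by rewrite /= -surjective_pairing -surjective_pairing.
Qed.

Lemma diffeo_germ_comp (Phi1 Phi1' Phi2 Phi2' : R * R -> R * R) p q r :
  diffeo_germ Phi1 Phi1' p q -> diffeo_germ Phi2 Phi2' q r ->
  diffeo_germ (Phi2 \o Phi1) (Phi1' \o Phi2') p r.
Proof.
move=> d1 d2; have [s1 s1' e1' K1 K1'] := diffeo_germP d1.
have [s2 s2' e2' K2 K2'] := diffeo_germP d2.
have [e1 _] := d1; have [e2 _] := d2.
apply: diffeo_germ_near.
- by apply: smooth_at_comp => //; rewrite e1.
- by apply: smooth_at_comp => //; rewrite e2'.
- by rewrite /= e1.
- have K : \forall x \near p, Phi2' (Phi2 (Phi1 x)) = Phi1 x.
    by move: K2; rewrite -e1; exact: (smooth_at_continuous s1).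
  by near=> x; rewrite /= (near K x)// (near K1 x).
- have K : \forall x \near r, Phi1 (Phi1' (Phi2' x)) = Phi2' x.
    by move: K1'; rewrite -e2'; exact: (smooth_at_continuous s2').
  by near=> x; rewrite /= (near K x)// (near K2' x).
Unshelve. all: by end_near. Qed.

(** This reduces the normal form problem on the minimal surface to one on an
explicit map in better source coordinates. *)
Lemma A_equivalent_reparam (S f X : R * R -> R * R * R) (chi chi' : R * R -> R * R)
    p q r : A_equivalent S q X r -> diffeo_germ chi chi' p q ->
  (\forall x \near p, f x = S (chi x)) -> A_equivalent f p X r.
Proof.
move=> [Phi [Phi' [Psi [Psi' [dPhi dPsi XE]]]]] dchi fS.
have [s s' e' K K'] := diffeo_germP dchi; have [e _] := dchi.
have [t t' h' H H'] := diffeo_germP dPhi; have [h _] := dPhi.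
exists (Phi \o chi), (chi' \o Phi'), Psi, Psi'; split.
- exact: diffeo_germ_comp dchi dPhi.
- by rewrite (nbhs_singleton fS) e.
have K1 : \forall x \near r, chi (chi' (Phi' x)) = Phi' x.
  by move: K'; rewrite -h'; exact: (smooth_at_continuous t').
have K2 : \forall x \near r, f (chi' (Phi' x)) = S (chi (chi' (Phi' x))).
  have c : {for r, continuous (chi' \o Phi')}.
    by apply: smooth_at_continuous; apply: smooth_at_comp => //; rewrite h'.
  by apply: (c [set z | f z = S (chi z)]); rewrite /= h' e'.
near=> x; rewrite (near XE x)//= (near K2 x)// (near K1 x)//.
Unshelve. all: by end_near. Qed.

End Germs.

Section S.
Context {R : realType}.

Lemma smooth_at_near_gt0 (V : normedModType R) (p : V) (f : V -> R) :
  smooth_at p f -> 0 < f p -> \forall x \near p, 0 < f x.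
Proof. by move=> /smooth_at_continuous cf fp; exact: cvgr_gt cf _ fp. Qed.

Lemma smooth_at_near_neq0 (V : normedModType R) (p : V) (f : V -> R) :
  smooth_at p f -> f p != 0 -> \forall x \near p, f x != 0.
Proof. by move=> /smooth_at_continuous cf fp; exact: cvgr_neq0 cf fp. Qed.

Lemma smooth_at_sqrt (V : normedModType R) (p : V) (f : V -> R) : 0 < f p ->
  smooth_at p f -> smooth_at p (fun x => Num.sqrt (f x)).
Proof.
move=> fp sf; apply: smooth_at_near_eq (smooth_at_powR (2^-1) fp sf).
near=> x; apply: powR12_sqrt; apply: ltW; near: x.
exact: smooth_at_near_gt0.
Unshelve. all: by end_near. Qed.

End S.

(** Smoothness of expressions; [assumption] comes first so that functions already
known to be smooth are not unfolded. *)
Ltac smooth_closure := repeat first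
  [ assumption | exact: smooth_at_cst | exact: smooth_at_id
  | apply: smooth_at_pair
  | apply: smooth_atB | apply: smooth_atD | apply: smooth_atN | apply: smooth_atM
  | apply: smooth_atX | apply: smooth_at_sqrt | apply: smooth_atV
  | apply: smooth_at_powR
  | (apply: smooth_at_fst) | (apply: smooth_at_snd) ].

(** * A folded polynomial surface with a cubic odd part *)

Section NormalForms.
Context {R : realType}.
Implicit Types (k : R) (x : R * R) (P : R * R * R).

(** The surface in the coordinates [E = u + u'], [D = u - u'], where [A] is
[u^2 + u'^2] and [B] is [(u u')^2].  The last summand of the third coordinate is
its odd part in [D]. *)
Definition folded k x : R * R * R :=
  let E := x.1 in let D := x.2 in
  let A := (E ^+ 2 + D ^+ 2) / 2 in let B := ((E ^+ 2 - D ^+ 2) / 4) ^+ 2 in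
  (((- k * (A + B) / 4, k * (A - B) / 4)),
   k * E ^+ 3 / 12 + k ^+ 2 * A * (6 * B - A ^+ 2) / 24
   + k * (1 - k * E ^+ 3 / 2) / 12 * D ^+ 3).

(** The functions [E], [D^2] and [(1 - k E^3 / 2) D^3] on the target, recovered
from [A] and [B]: [E^2 = A + 2 sqrt B], [D^2 = A - 2 sqrt B], and the odd part of
the third coordinate up to the factor [12 / k]. *)
Definition coordE k P : R :=
  let A := - 2 * (P.1.1 - P.1.2) / k in let B := - 2 * (P.1.1 + P.1.2) / k in
  Num.sqrt (A + 2 * Num.sqrt B).
Definition coordZ k P : R :=
  let A := - 2 * (P.1.1 - P.1.2) / k in let B := - 2 * (P.1.1 + P.1.2) / k in
  A - 2 * Num.sqrt B.
Definition coordR k P : R :=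
  let A := - 2 * (P.1.1 - P.1.2) / k in let B := - 2 * (P.1.1 + P.1.2) / k in
  12 / k * (P.2 - k * coordE k P ^+ 3 / 12 - k ^+ 2 * A * (6 * B - A ^+ 2) / 24).

Definition of_coords k (E Z Q : R) : R * R * R :=
  let A := (E ^+ 2 + Z) / 2 in let B := ((E ^+ 2 - Z) / 4) ^+ 2 in
  (((- k * (A + B) / 4, k * (A - B) / 4)),
   k * E ^+ 3 / 12 + k ^+ 2 * A * (6 * B - A ^+ 2) / 24 + k / 12 * Q).

Lemma foldedE k x : folded k x =
  of_coords k x.1 (x.2 ^+ 2) ((1 - k * x.1 ^+ 3 / 2) * x.2 ^+ 3).
Proof. by congr (_, _); rewrite /=; ring. Qed.

Lemma coords_of_coords k E Z Q : 0 < k -> 0 < E -> 0 < E ^+ 2 - Z ->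
  [/\ coordE k (of_coords k E Z Q) = E, coordZ k (of_coords k E Z Q) = Z &
      coordR k (of_coords k E Z Q) = Q].
Proof.
move=> k0 E0 Z0.
have k1 : k != 0 by rewrite gt_eqF.
set P := of_coords _ _ _ _.
have A : - 2 * (P.1.1 - P.1.2) / k = (E ^+ 2 + Z) / 2 by rewrite /P /of_coords /=; field.
have B : - 2 * (P.1.1 + P.1.2) / k = ((E ^+ 2 - Z) / 4) ^+ 2 by rewrite /P /of_coords /=; field.
have b : Num.sqrt (- 2 * (P.1.1 + P.1.2) / k) = (E ^+ 2 - Z) / 4.
  by rewrite B sqrtr_sqr gtr0_norm// divr_gt0.
have EE : coordE k P = E.
  rewrite /coordE b A (_ : (E ^+ 2 + Z) / 2 + _ = E ^+ 2); last by field.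
  by rewrite sqrtr_sqr gtr0_norm.
split=> //; first by rewrite /coordZ b A; field.
by rewrite /coordR EE A B /P /of_coords /=; field.
Qed.

Lemma of_coordsK k P : 0 < k ->
  let A := - 2 * (P.1.1 - P.1.2) / k in let B := - 2 * (P.1.1 + P.1.2) / k in
  0 < B -> 0 < A + 2 * Num.sqrt B ->
  of_coords k (coordE k P) (coordZ k P) (coordR k P) = P.
Proof.
move=> k0 A B B0 A0; have k1 : k != 0 by rewrite gt_eqF.
case: P @A @B B0 A0 => [[p1 p2] p3] A B B0 A0.
rewrite /of_coords /coordR; set E := coordE _ _.
have E2 : E ^+ 2 = A + 2 * Num.sqrt B by rewrite sqr_sqrtr// ltW.
rewrite /coordZ -/A -/B E2.
have -> : (A + 2 * Num.sqrt B + (A - 2 * Num.sqrt B)) / 2 = A by field.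
have -> : (A + 2 * Num.sqrt B - (A - 2 * Num.sqrt B)) / 4 = Num.sqrt B by field.
rewrite sqr_sqrtr ?(ltW B0)//.
congr (_, _); last by rewrite /=; field.
by rewrite /A /B /=; congr (_, _); field.
Qed.

Lemma smooth_at_of_coords (V : normedModType R) k (p : V) (E Z Q : V -> R) :
  smooth_at p E -> smooth_at p Z -> smooth_at p Q ->
  smooth_at p (fun z => of_coords k (E z) (Z z) (Q z)).
Proof. by move=> sE sZ sQ; rewrite /of_coords /=; smooth_closure. Qed.

(** In the target coordinates [(E, Z, Q)] the surface is
[(E, D^2, (1 - k E^3 / 2) D^3)].  The reparametrization [xi] of [E] and the
factor [rho] leave room for both outcomes: at a point where the cubic
coefficient does not vanish, [rho] divides it out; at a simple zero, [xi] takes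
the coefficient itself as coordinate. *)
Lemma folded_A_equivalent k (xi xi' rho : R -> R) (X : R * R -> R * R * R) :
  0 < k -> smooth_at (2 : R) xi -> smooth_at (0 : R) xi' ->
  smooth_at (2 : R) rho -> xi 2 = 0 ->
  (\forall e \near (2 : R), xi' (xi e) = e) ->
  (\forall a \near (0 : R), xi (xi' a) = a) -> rho 2 != 0 ->
  (\forall x \near ((0, 0) : R * R),
     X x = (x.1, x.2 ^+ 2, rho (xi' x.1) * (1 - k * xi' x.1 ^+ 3 / 2) * x.2 ^+ 3)) ->
  A_equivalent (folded k) (2, 0) X (0, 0).
Proof.
move=> k0 sxi sxi' srho xi2 K K' rho0 XE.
have k1 : k != 0 by rewrite gt_eqF.
have xi'0 : xi' 0 = 2 by rewrite -xi2 (nbhs_singleton K).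
pose Phi x : R * R := (xi x.1, x.2).
pose Phi' x : R * R := (xi' x.1, x.2).
pose Psi P : R * R * R :=
  (xi (coordE k P), coordZ k P, rho (coordE k P) * coordR k P).
pose Psi' P : R * R * R :=
  of_coords k (xi' P.1.1) P.1.2 ((rho (xi' P.1.1))^-1 * P.2).
pose P0 := folded k (2, 0).
have P0E : P0 = of_coords k 2 0 0.
  by rewrite /P0 foldedE /= !expr0n /= mulr0.
have [E0 Z0 Q0] : [/\ coordE k P0 = 2, coordZ k P0 = 0 & coordR k P0 = 0].
  by rewrite P0E; apply: coords_of_coords => //; rewrite ?subr0 ?exprn_gt0.
have B0 : 0 < - 2 * (P0.1.1 + P0.1.2) / k.
  by rewrite (_ : _ / k = 1) //; rewrite P0E /of_coords /=; field.
have A0 : 0 < - 2 * (P0.1.1 - P0.1.2) / k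
            + 2 * Num.sqrt (- 2 * (P0.1.1 + P0.1.2) / k).
  rewrite ltr_wpDr// ?mulr_ge0 ?sqrtr_ge0//.
  by rewrite (_ : _ / k = 2) //; rewrite P0E /of_coords /=; field.
have sB : smooth_at P0 (fun P => - 2 * (P.1.1 + P.1.2) / k) by smooth_closure.
have sA : smooth_at P0 (fun P => - 2 * (P.1.1 - P.1.2) / k
            + 2 * Num.sqrt (- 2 * (P.1.1 + P.1.2) / k)) by smooth_closure.
have sE : smooth_at P0 (coordE k) by rewrite /coordE /=; smooth_closure.
have sZ : smooth_at P0 (coordZ k) by rewrite /coordZ /=; smooth_closure.
have sQ : smooth_at P0 (coordR k).
  by rewrite /coordR /=; smooth_closure.
have near_E (T : R -> Prop) : (\forall e \near (2 : R), T e) ->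
    \forall P \near P0, T (coordE k P).
  by rewrite -[in X in X -> _]E0; exact: (smooth_at_continuous sE).
have near_fst (e : R) (T : R -> Prop) : (\forall a \near e, T a) ->
    \forall x \near ((e, 0) : R * R), T x.1.
  exact: (smooth_at_continuous (smooth_at_fst (@smooth_at_id _ _ ((e, 0) : R * R)))).
have sx1 : smooth_at ((0, 0, 0) : R * R * R) (fun P : R * R * R => P.1.1) by smooth_closure.
have sx2 : smooth_at ((0, 0, 0) : R * R * R) (fun P : R * R * R => P.1.2) by smooth_closure.
have sxi0 : smooth_at ((0, 0, 0) : R * R * R) (fun P : R * R * R => xi' P.1.1).
  exact: smooth_at_comp1.
have srho0 : smooth_at ((0, 0, 0) : R * R * R) (fun P : R * R * R => rho (xi' P.1.1)).
  by apply: smooth_at_comp1 => //; rewrite /= xi'0.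
have near_xi' : \forall P \near ((0, 0, 0) : R * R * R),
    [/\ 0 < xi' P.1.1, 0 < xi' P.1.1 ^+ 2 - P.1.2, rho (xi' P.1.1) != 0 &
       xi (xi' P.1.1) = P.1.1].
  have d0 : 0 < xi' 0 ^+ 2 - 0 by rewrite xi'0 subr0 exprn_gt0.
  have sd := smooth_atB (smooth_atX 2 sxi0) sx2.
  have p1 : 0 < xi' 0 by rewrite xi'0.
  have r1 : rho (xi' 0) != 0 by rewrite xi'0.
  have N1 := smooth_at_near_gt0 sxi0 p1.
  have N2 := smooth_at_near_gt0 sd d0.
  have N3 := smooth_at_near_neq0 srho0 r1.
  have N4 : \forall P \near ((0, 0, 0) : R * R * R), xi (xi' P.1.1) = P.1.1.
    exact: smooth_at_continuous sx1 _ K'.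
  near=> P; split;
    [exact: (near N1 P)|exact: (near N2 P)|exact: (near N3 P)|exact: (near N4 P)].
exists Phi, Phi', Psi, Psi'; split.
- apply: diffeo_germ_near.
  + by apply: smooth_at_pair; smooth_closure; apply: smooth_at_comp1 => //; smooth_closure.
  + by apply: smooth_at_pair; smooth_closure; apply: smooth_at_comp1 => //; smooth_closure.
  + by rewrite /Phi /= xi2.
  + near=> x; rewrite [RHS]surjective_pairing /Phi' /Phi /=; congr (_, _).
    exact: (near (near_fst _ (fun e => xi' (xi e) = e) K) x).
  + near=> x; rewrite [RHS]surjective_pairing /Phi' /Phi /=; congr (_, _).
    exact: (near (near_fst _ (fun a => xi (xi' a) = a) K') x).
- have -> : X (0, 0) = (0, 0, 0).
    by rewrite (nbhs_singleton XE) /= !expr0n /= mulr0.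
  apply: diffeo_germ_near.
  + apply: smooth_at_pair; first apply: smooth_at_pair => //.
      by apply: smooth_at_comp1 => //; rewrite E0.
    by apply: smooth_atM => //; apply: smooth_at_comp1 => //; rewrite E0.
  + apply: smooth_at_of_coords => //.
    apply: smooth_atM; last by smooth_closure.
    by apply: smooth_atV => //=; rewrite xi'0.
  + by rewrite /Psi E0 Z0 Q0 xi2 mulr0.
  + have BP : \forall P \near P0, 0 < - 2 * (P.1.1 + P.1.2) / k by exact: smooth_at_near_gt0.
    have AP := smooth_at_near_gt0 sA A0.
    have KP := near_E _ K.
    have rP : \forall P \near P0, rho (coordE k P) != 0.
      apply: (near_E (fun e => rho e != 0)); exact: smooth_at_near_neq0.
    near=> P; rewrite /Psi' /Psi /= (near KP P)// mulKf; last exact: (near rP P).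
    by apply: of_coordsK => //; [exact: (near BP P)|exact: (near AP P)].
  + near=> P; have [x0 xZ xrho xxi] : [/\ 0 < xi' P.1.1,
        0 < xi' P.1.1 ^+ 2 - P.1.2, rho (xi' P.1.1) != 0 &
        xi (xi' P.1.1) = P.1.1] by near: P.
    rewrite /Psi /Psi'.
    have [-> -> ->] := coords_of_coords ((rho (xi' P.1.1))^-1 * P.2) k0 x0 xZ.
    by rewrite xxi mulVKf// -!surjective_pairing.
have near_xi'2 : \forall x \near ((0, 0) : R * R),
    [/\ 0 < xi' x.1, 0 < xi' x.1 ^+ 2 - x.2 ^+ 2 & xi (xi' x.1) = x.1].
  have s1 : smooth_at ((0, 0) : R * R) (fun x => xi' x.1).
    by apply: smooth_at_comp1 => //; smooth_closure.
  have s2 : smooth_at ((0, 0) : R * R) (fun x : R * R => xi' x.1 ^+ 2 - x.2 ^+ 2).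
    by apply: smooth_atB; [exact: smooth_atX|smooth_closure].
  have p1 : 0 < xi' 0 by rewrite xi'0.
  have p2 : 0 < xi' 0 ^+ 2 - 0 ^+ 2 by rewrite xi'0 expr0n subr0 exprn_gt0.
  have N1 := smooth_at_near_gt0 s1 p1.
  have N2 := smooth_at_near_gt0 s2 p2.
  have N3 := near_fst _ (fun a => xi (xi' a) = a) K'.
  by near=> x; split;
    [exact: (near N1 x)|exact: (near N2 x)|exact: (near N3 x)].
near=> x; rewrite (near XE x)// /Psi foldedE /Phi' /=.
have [x0 xZ xxi] : [/\ 0 < xi' x.1, 0 < xi' x.1 ^+ 2 - x.2 ^+ 2 &
  xi (xi' x.1) = x.1] by near: x.
have [-> -> ->] := coords_of_coords ((1 - k * xi' x.1 ^+ 3 / 2) * x.2 ^+ 3) k0 x0 xZ.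
by rewrite xxi !mulrA.
Unshelve. all: by end_near. Qed.

End NormalForms.

(** * Singularities of the ruled maps *)

Section Ruled.
Context {R : realType}.
Implicit Types (k : R) (x : R * R) (P : R * R * R).

(** The surface in the coordinates [(u, w)], with [p = f1 + f2], [q = f1 - f2]. *)
Definition ruled (K L M : R -> R) x : R * R * R :=
  let u := x.1 in let w := x.2 in
  let p := - u - u ^+ 2 * w - L u in let q := - w - K u in
  ((p + q) / 2, (p - q) / 2, K u * (u + u ^+ 2 * w) - L u * w + M u).

(** Primitives of [H], [u^2 H] and [H (u^2 K - u - L)] for
[H = - 1 / (2 u^2) + 2 k u]. *)
Definition cuspK k (u : R) : R := (2 * u)^-1 + k * u ^+ 2.
Definition cuspL k (u : R) : R := - u / 2 + k * u ^+ 4 / 2.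
Definition cuspM k (u : R) : R := - k * u ^+ 3 / 12 + k ^+ 2 * u ^+ 6 / 6.

(** The fold partner [u'] of [u], which solves [u^2 + u'^2 = 2 (w + K u) / k]. *)
Definition partner k x : R := Num.sqrt (x.1 ^+ 2 + (2 * x.2 + x.1^-1) / k).
Definition sum_diff k x : R * R := (x.1 + partner k x, x.1 - partner k x).
Definition of_sum_diff k x : R * R :=
  let u := (x.1 + x.2) / 2 in let u' := (x.1 - x.2) / 2 in
  (u, k * (u' ^+ 2 - u ^+ 2) / 2 - (2 * u)^-1).

Lemma sum_diffK k x : 0 < k -> x.1 != 0 ->
  0 < x.1 ^+ 2 + (2 * x.2 + x.1^-1) / k -> of_sum_diff k (sum_diff k x) = x.
Proof.
move=> k0 u0 s0; have k1 : k != 0 by rewrite gt_eqF.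
rewrite [RHS]surjective_pairing /of_sum_diff /=.
have -> : (x.1 + partner k x + (x.1 - partner k x)) / 2 = x.1 by field.
have -> : (x.1 + partner k x - (x.1 - partner k x)) / 2 = partner k x by field.
by rewrite sqr_sqrtr ?(ltW s0)//; congr (_, _); field; rewrite u0.
Qed.

Lemma of_sum_diffK k x : 0 < k -> 0 < x.1 + x.2 -> 0 < x.1 - x.2 ->
  sum_diff k (of_sum_diff k x) = x.
Proof.
case: x => a b k0 /= s d0.
have [k1 s1] : k != 0 /\ a + b != 0 by rewrite !gt_eqF.
have r : partner k (of_sum_diff k (a, b)) = (a - b) / 2.
  rewrite /partner [X in Num.sqrt X](_ : _ = ((a - b) / 2) ^+ 2).
    by rewrite sqrtr_sqr gtr0_norm// divr_gt0.
  by rewrite /of_sum_diff /=; field; rewrite s1 k1.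
by rewrite /sum_diff r /=; congr (_, _); field.
Qed.

Lemma ruled_sum_diff k x : 0 < k -> x.1 != 0 ->
  0 < x.1 ^+ 2 + (2 * x.2 + x.1^-1) / k ->
  ruled (cuspK k) (cuspL k) (cuspM k) x = folded k (sum_diff k x).
Proof.
move=> k0 u0 s0.
rewrite -{1}(sum_diffK k0 u0 s0) /sum_diff; move: (partner k x) => s.
rewrite /of_sum_diff /=.
have -> : (x.1 + s + (x.1 - s)) / 2 = x.1 by field.
have -> : (x.1 + s - (x.1 - s)) / 2 = s by field.
rewrite /ruled /folded /cuspK /cuspL /cuspM /=.
by congr (_, _); [congr (_, _)|]; field.
Qed.

Lemma diffeo_germ_sum_diff k : 0 < k ->
  diffeo_germ (sum_diff k) (of_sum_diff k) (1, - 2^-1) (2, 0).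
Proof.
move=> k0; have k1 : k != 0 by rewrite gt_eqF.
have r1 : (1 : R) ^+ 2 + (2 * - 2^-1 + 1^-1) / k = 1 by field.
have s0 : smooth_at ((1, - 2^-1) : R * R)
    (fun x : R * R => x.1 ^+ 2 + (2 * x.2 + x.1^-1) / k).
  by smooth_closure; rewrite /= oner_eq0.
have sp : smooth_at ((1, - 2^-1) : R * R) (partner k).
  by apply: smooth_at_sqrt => //=; rewrite r1.
have near_p : \forall x \near ((1, - 2^-1) : R * R), [/\ x.1 != 0 &
    0 < x.1 ^+ 2 + (2 * x.2 + x.1^-1) / k].
  have p1 : (1 : R) != 0 by rewrite oner_eq0.
  have p2 : 0 < (1 : R) ^+ 2 + (2 * - 2^-1 + 1^-1) / k by rewrite r1.
  have s1 : smooth_at ((1, - 2^-1) : R * R) (fun x => x.1) by smooth_closure.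
  have N1 := smooth_at_near_neq0 s1 p1.
  have N2 := smooth_at_near_gt0 s0 p2.
  by near=> x; split; [exact: (near N1 x)|exact: (near N2 x)].
have s1 : smooth_at ((2, 0) : R * R) (fun x : R * R => x.1 + x.2) by smooth_closure.
have s2 : smooth_at ((2, 0) : R * R) (fun x : R * R => x.1 - x.2) by smooth_closure.
have near_q : \forall x \near ((2, 0) : R * R), [/\ 0 < x.1 + x.2 & 0 < x.1 - x.2].
  have p1 : 0 < (2 : R) + 0 by rewrite addr0.
  have p2 : 0 < (2 : R) - 0 by rewrite subr0.
  have N1 := smooth_at_near_gt0 s1 p1.
  have N2 := smooth_at_near_gt0 s2 p2.
  by near=> x; split; [exact: (near N1 x)|exact: (near N2 x)].
apply: diffeo_germ_near.
- by apply: smooth_at_pair; [apply: smooth_atD|apply: smooth_atB] => //; smooth_closure.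
- rewrite /of_sum_diff /=; smooth_closure.
  by rewrite //= addr0 mulf_neq0 ?divff ?oner_neq0// pnatr_eq0.
- by rewrite /sum_diff /partner /= r1 sqrtr1 subrr.
- near=> x; have [x0 s] : [/\ x.1 != 0 & 0 < x.1 ^+ 2 + (2 * x.2 + x.1^-1) / k]
    by near: x.
  exact: sum_diffK.
near=> x; have [x0 s] : [/\ 0 < x.1 + x.2 & 0 < x.1 - x.2] by near: x.
exact: of_sum_diffK.
Unshelve. all: by end_near. Qed.

(** The point [(1, - 1/2)] is fixed by the fold: there [u = u' = 1], that is
[E = 2] and [D = 0]. *)
Lemma ruled_A_equivalent k (X : R * R -> R * R * R) : 0 < k ->
  A_equivalent (folded k) (2, 0) X (0, 0) ->
  A_equivalent (ruled (cuspK k) (cuspL k) (cuspM k)) (1, - 2^-1) X (0, 0).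
Proof.
move=> k0 AX; apply: (A_equivalent_reparam AX (diffeo_germ_sum_diff k0)).
have k1 : k != 0 by rewrite gt_eqF.
have s0 : smooth_at ((1, - 2^-1) : R * R)
    (fun x : R * R => x.1 ^+ 2 + (2 * x.2 + x.1^-1) / k).
  by smooth_closure; rewrite /= oner_eq0.
have s1 : smooth_at ((1, - 2^-1) : R * R) (fun x => x.1) by smooth_closure.
have p1 : (1 : R) != 0 by rewrite oner_eq0.
have p2 : 0 < (1 : R) ^+ 2 + (2 * - 2^-1 + 1^-1) / k.
  by rewrite (_ : _ + _ = 1)//; field.
have N1 := smooth_at_near_neq0 s1 p1.
have N2 := smooth_at_near_gt0 s0 p2.
by near=> x; apply: ruled_sum_diff => //; [exact: (near N1 x)|exact: (near N2 x)].
Unshelve. all: by end_near. Qed.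

(** For [k = 1/2] the cubic coefficient [1 - E^3 / 4] is [- 1] at [E = 2]. *)
Lemma cuspidal_edge_ruled :
  A_equivalent (ruled (cuspK 2^-1) (cuspL 2^-1) (cuspM 2^-1)) (1, - 2^-1)
    cuspidal_edge (0, 0).
Proof.
have h0 : 0 < 2^-1 :> R by rewrite invr_gt0.
apply: ruled_A_equivalent => //.
have r2 : 1 - 2^-1 * 2 ^+ 3 / 2 != 0 :> R.
  by rewrite (_ : 1 - _ = - 1) ?oppr_eq0 ?oner_eq0//; field.
have s2 : smooth_at (2 : R) (fun e : R => 1 - 2^-1 * e ^+ 3 / 2) by smooth_closure.
apply: (@folded_A_equivalent _ _ (fun e => e - 2) (fun a => a + 2)
  (fun e => (1 - 2^-1 * e ^+ 3 / 2)^-1)) => //.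
- by smooth_closure.
- by smooth_closure.
- exact: smooth_atV.
- by rewrite subrr.
- by near=> e; rewrite subrK.
- by near=> e; rewrite addrK.
- by rewrite invr_neq0.
have s0 : smooth_at ((0, 0) : R * R) (fun x => 1 - 2^-1 * (x.1 + 2) ^+ 3 / 2) by smooth_closure.
have r0 : 1 - 2^-1 * (0 + 2) ^+ 3 / 2 != 0 :> R by rewrite add0r.
have N := smooth_at_near_neq0 s0 r0.
near=> x; rewrite mulVf ?mul1r; last exact: (near N x).
by rewrite [X in cuspidal_edge X](surjective_pairing x).
Unshelve. all: by end_near. Qed.

(** For [k = 1/4] the cubic coefficient [1 - E^3 / 8] has a simple zero at
[E = 2] and serves as the first coordinate; its inverse is a cube root. *)
Lemma cuspidal_cross_cap_ruled :
  A_equivalent (ruled (cuspK 4^-1) (cuspL 4^-1) (cuspM 4^-1)) (1, - 2^-1)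
    cuspidal_cross_cap (0, 0).
Proof.
have h0 : 0 < 4^-1 :> R by rewrite invr_gt0.
apply: ruled_A_equivalent => //.
have cube_root (a : R) : 0 <= a -> (a ^+ 3) `^ 3^-1 = a.
  by move=> a0; rewrite -powR_mulrn// -powRrM mulfV ?pnatr_eq0// powRr1.
have root_cube (a : R) : 0 <= a -> (a `^ 3^-1) ^+ 3 = a.
  by move=> a0; rewrite -powR_mulrn ?powR_ge0// -powRrM mulVf ?pnatr_eq0// powRr1.
have s0 : smooth_at (0 : R) (fun a : R => 1 - a) by smooth_closure.
have n0 : \forall a \near (0 : R), 0 < 1 - a.
  by apply: smooth_at_near_gt0 => //; rewrite subr0.
apply: (@folded_A_equivalent _ _ (fun e => 1 - 4^-1 * e ^+ 3 / 2)
  (fun a => 2 * (1 - a) `^ 3^-1) (fun=> 1)) => //.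
- by smooth_closure.
- by smooth_closure; rewrite /= subr0.
- by smooth_closure.
- by field.
- have N : \forall e \near (2 : R), 0 < e by exact: smooth_at_near_gt0 (smooth_at_id _) _.
  near=> e; have e0 : 0 < e by exact: (near N e).
  rewrite (_ : 1 - _ = (e / 2) ^+ 3); last by field.
  by rewrite cube_root ?divr_ge0 ?ltW//; field.
- near=> a; have a0 : 0 < 1 - a by exact: (near n0 a).
  by rewrite exprMn root_cube ?ltW//; field.
have N : \forall x \near ((0, 0) : R * R), 0 < 1 - x.1.
  by apply: smooth_at_near_gt0; [smooth_closure|rewrite /= subr0].
near=> x; have a0 : 0 < 1 - x.1 by exact: (near N x).
rewrite exprMn root_cube ?ltW// [X in cuspidal_cross_cap X](surjective_pairing x).
by congr (_, _); field.
Unshelve. all: by end_near. Qed.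

(** Primitives of [H], [u^2 H] and [H (u^2 K - u - L)] for [H = - 1/2]. *)
Definition tailK (u : R) : R := - u / 2.
Definition tailL (u : R) : R := - u ^+ 3 / 6.
Definition tailM (u : R) : R := u ^+ 2 / 4 + u ^+ 4 / 24.

(** With [q = f1 - f2] and [p = f1 + f2], the surface is the envelope of the planes
[f3 - u p / 2 + u^3 q / 6 = u^2 / 4 + u^4 / 24].  Their equation is quartic in
[u]; removing the cubic term by [u = q + x] gives [x^4 + y x^2 - b x + c = 0]
with [y = 6 (1 - q^2)].  The envelope is where [x] is a double root, that is
[b = 4 x^3 + 2 x y] and [c = 3 x^4 + x^2 y]. *)
Lemma swallowtail_ruled :
  A_equivalent (ruled tailK tailL tailM) (1, - 2^-1) swallowtail (0, 0).
Proof.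
pose q x : R := x.1 / 2 - x.2.
pose Phi x : R * R := (x.1 - q x, 6 * (1 - q x ^+ 2)).
pose root (y : R) : R := Num.sqrt (1 - y / 6).
pose Phi' x : R * R := (root x.2 + x.1, (x.1 - root x.2) / 2).
pose b P : R := 4 * (- 3 * (P.1.1 + P.1.2) + 2 * (P.1.1 - P.1.2) ^+ 3
                     - 3 * (P.1.1 - P.1.2)).
pose Psi P : R * R * R :=
  (- 24 * P.2 - (P.1.1 - P.1.2) * b P
     + 5 * (P.1.1 - P.1.2) ^+ 4 - 6 * (P.1.1 - P.1.2) ^+ 2,
   b P, 6 * (1 - (P.1.1 - P.1.2) ^+ 2)).
pose Psi' P : R * R * R :=
  let s := root P.2 in
  let p := (2 * s ^+ 3 - 3 * s - P.1.2 / 4) / 3 in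
  ((p + s) / 2, (p - s) / 2,
   (5 * s ^+ 4 - 6 * s ^+ 2 - s * P.1.2 - P.1.1) / 24).
have rootK (s : R) : 0 < s -> root (6 * (1 - s ^+ 2)) = s.
  move=> s0; rewrite /root (_ : 1 - _ = s ^+ 2); last by field.
  by rewrite sqrtr_sqr gtr0_norm.
have q0 : q (1, - 2^-1) = 1 by rewrite /q /=; field.
have sq_root y : 0 < 1 - y / 6 -> root y ^+ 2 = 1 - y / 6.
  by move=> y0; rewrite sqr_sqrtr ?ltW.
pose P0 := ruled tailK tailL tailM (1, - 2^-1).
have P0E : P0.1.1 - P0.1.2 = 1.
  by rewrite /P0 /ruled /tailK /tailL /tailM /=; field.
exists Phi, Phi', Psi, Psi'; split.
- apply: diffeo_germ_near.
  + by rewrite /Phi /q; smooth_closure.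
  + by rewrite /Phi' /root; smooth_closure; rewrite /= mul0r subr0.
  + by rewrite /Phi /q /=; congr (_, _); field.
  + have N : \forall x \near ((1, - 2^-1) : R * R), 0 < q x.
      by apply: smooth_at_near_gt0; [rewrite /q; smooth_closure|rewrite q0].
    near=> x; rewrite /Phi' /Phi /= rootK; last exact: (near N x).
    by rewrite [RHS]surjective_pairing /q; congr (_, _); field.
  have N : \forall x \near ((0, 0) : R * R), 0 < 1 - x.2 / 6.
    by apply: smooth_at_near_gt0; [smooth_closure|rewrite /= mul0r subr0].
  near=> x; rewrite /Phi /Phi' /= (_ : q _ = root x.2); last by rewrite /q/=; field.
  rewrite sq_root; last exact: (near N x).
  by rewrite [RHS]surjective_pairing; congr (_, _); field.
- apply: diffeo_germ_near.
  + by rewrite /Psi /b; smooth_closure.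
  + by rewrite /swallowtail /Psi' /root /=; smooth_closure; rewrite /= ?mulr0 ?mul0r subr0.
  + by rewrite -/P0 /Psi /b /P0 /ruled /tailK /tailL /tailM /=; congr (_, _, _); field.
  + have N : \forall P \near P0, 0 < P.1.1 - P.1.2.
      by apply: smooth_at_near_gt0; [smooth_closure|rewrite P0E].
    near=> P; rewrite /Psi' /Psi /= rootK; last exact: (near N P).
    rewrite [RHS]surjective_pairing [in RHS](surjective_pairing P.1) /b.
    by congr (_, _, _); field.
  have -> : swallowtail (0, 0) = (0, 0, 0) :> R * R * R.
    by rewrite /swallowtail !expr0n /= !mulr0 ?mul0r ?addr0.
  have N : \forall P \near ((0, 0, 0) : R * R * R), 0 < 1 - P.2 / 6.
    by apply: smooth_at_near_gt0; [smooth_closure|rewrite /= mul0r subr0].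
  near=> P; rewrite [RHS]surjective_pairing [in RHS](surjective_pairing P.1).
  have r0 : 0 < 1 - P.2 / 6 by exact: (near N P).
  have r2 := sq_root P.2 r0.
  rewrite /Psi /Psi' /b /=; move: (root P.2) r2 => s r2.
  rewrite (_ : P.2 = 6 * (1 - s ^+ 2)); last by rewrite r2; field.
  by congr (_, _, _); field.
have N : \forall x \near ((0, 0) : R * R), 0 < 1 - x.2 / 6.
  by apply: smooth_at_near_gt0; [smooth_closure|rewrite /= mul0r subr0].
near=> x; have r0 : 0 < 1 - x.2 / 6 by exact: (near N x).
have := sq_root x.2 r0.
rewrite /Phi' [X in swallowtail X](surjective_pairing x).
move: (x.1) (x.2) (root x.2) {r0} => a y s r2 /=.
have {r2}-> : y = 6 * (1 - s ^+ 2) by rewrite r2 /=; field.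
by rewrite /Psi /b /ruled /tailK /tailL /tailM /=; congr (_, _, _); field.
Unshelve. all: by end_near. Qed.

End Ruled.

(** * Convex domains and line integrals *)

Section Convex.
Context {R : realType}.
Implicit Types (D : set (R * R)).

Definition segment_closed (V : lmodType R) (D : set V) :=
  forall a b (t : R), D a -> D b -> t \in `[0, 1] -> D (a + t *: (b - a)).

Lemma ball_segment_closed (V : normedModType R) (p : V) (r : R) :
  segment_closed (ball p r).
Proof.
move=> a b t; rewrite -ball_normE /= => pa pb /[!in_itv]/= /andP[t0 t1].
have -> : p - (a + t *: (b - a)) = (1 - t) *: (p - a) + t *: (p - b).
  rewrite scalerBl scale1r opprD addrA -[RHS]addrA; congr (_ + _).
  by rewrite -!scalerN -scalerDr !opprB addrA subrK.
rewrite (le_lt_trans (ler_normD _ _))// !normrZ ger0_norm ?subr_ge0// ger0_norm//.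
have [->|t0'] := eqVneq t 0; first by rewrite subr0 mul1r mul0r addr0.
have tp : 0 < t by rewrite lt_neqAle eq_sym t0'.
have -> : r = (1 - t) * r + t * r by ring.
by rewrite ler_ltD// ?ltr_pM2l// ler_wpM2l ?subr_ge0// ltW.
Qed.

Lemma affine_path_continuous (a b : R * R) :
  continuous (fun t : R => a + t *: (b - a)).
Proof. by move=> t; apply: cvgD; [exact: cvg_cst|exact: scalel_continuous]. Qed.

Lemma segment_closed_connected (D : set (R * R)) : segment_closed D -> connected D.
Proof.
move=> sD; have [->|/set0P[a Da]] := eqVneq D set0; first exact: connected0.
have -> : D = \bigcup_(b in D) (fun t : R => a + t *: (b - a)) @` `[0, 1].
  apply/seteqP; split=> [b Db|b [c Dc [t t01 <-]]]; last exact: sD.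
  exists b => //; exists 1; first by rewrite /= in_itv/= ler01 lexx.
  by rewrite scale1r addrC subrK.
apply: bigcup_connected => [|b Db].
  exists a => b Db; exists 0; first by rewrite /= in_itv/= ler01 lexx.
  by rewrite scale0r addr0.
apply: connected_continuous_connected; first exact: segment_connected.
by apply: continuous_subspaceT; exact: affine_path_continuous.
Qed.

(** Loops are contracted along segments to their base point. *)
Lemma segment_closed_simply_connected (D : set (R * R)) :
  segment_closed D -> simply_connected D.
Proof.
move=> sD; split=> [a b Da Db|gamma cgamma Dgamma loop].
  exists (fun t => a + t *: (b - a)); split.
  - by apply: continuous_subspaceT; exact: affine_path_continuous.
  - by move=> t t01; exact: sD.
  - by rewrite scale0r addr0.
  - by rewrite scale1r addrC subrK.
have D0 : D (gamma 0) by apply: Dgamma; rewrite in_itv/= lexx ler01.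
exists (fun st => gamma st.2 + st.1 *: (gamma 0 - gamma st.2)); split.
- have cg : {within `[0, 1] `*` `[0, 1], continuous (fun st : R * R => gamma st.2)}.
    apply/subspace_continuousP => -[s t] [/= s01 t01].
    move/subspace_continuousP : cgamma => /(_ t t01) ct.
    move=> A nA; have h : \forall x \near (s, t), `[0, 1]%classic x.2 -> A (gamma x.2).
      exact: (@cvg_snd _ _ (nbhs s) (nbhs t) _ _ (ct A nA)).
    by apply: filterS h => x h [_ /h].
  move=> st; apply: cvgD; first exact: cg.
  apply: cvgZ; last by apply: cvgB; [exact: cvg_cst|exact: cg].
  by apply: (@continuous_subspaceT _ _ _ (fun x : R * R => x.1)) => x; exact: cvg_fst.
- by move=> s t s01 t01 /=; apply: sD => //; exact: Dgamma.
- by move=> t _ /=; rewrite scale0r addr0.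
- by move=> t _ /=; rewrite scale1r addrC subrK.
- by move=> s _ /=; rewrite -loop subrr scaler0 addr0.
Qed.

(** The fundamental theorem of calculus along arcs: a function whose differential
is the real part of [phi dz] is a primitive. *)
Lemma re_integral_primitive D (phi : R * R -> R * R) (F : R * R -> R) :
  (forall z, D z -> {for z, continuous phi}) ->
  (forall z, D z -> is_diff z F (fun h => pcre (pcmul (phi z) h))) ->
  re_integral D phi F.
Proof.
move=> cphi dF gamma [dgamma cgamma Dgamma].
have dg (t : R) : t \in `[0, 1] -> differentiable gamma t.
  by move=> /dgamma /derivable1_diffP.
have dFg (t : R) : t \in `[0, 1] -> is_derive t 1 (F \o gamma)
    (pcre (pcmul (phi (gamma t)) (derive1 gamma t))).
  move=> t01; have [dFt eF] := dF _ (Dgamma t t01); have dgt := dg t t01.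
  have dc := differentiable_comp dgt dFt.
  apply: DeriveDef; first exact: diff_derivable.
  by rewrite (deriveE _ dc) diff_comp//= eF derive1E (deriveE _ dgt).
have cFg (t : R) : t \in `[0, 1] -> {for t, continuous (F \o gamma)}.
  by move=> /dFg [/derivable1_diffP /differentiable_continuous].
pose f (t : R) := pcre (pcmul (phi (gamma t)) (derive1 gamma t)).
have cf : {within `[0, 1], continuous f}.
  have cp : {within `[0, 1], continuous (phi \o gamma)}.
    apply: continuous_in_subspaceT => t /[!inE] t01.
    apply: continuous_comp; first exact/differentiable_continuous/dg.
    exact/cphi/Dgamma.
  move=> t; rewrite /f /pcre /pcmul /=; apply: cvgD; apply: cvgM.
  - by apply: (cvg_comp _ _ (cp t)); exact: cvg_fst.
  - by apply: (cvg_comp _ _ (cgamma t)); exact: cvg_fst.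
  - by apply: (cvg_comp _ _ (cp t)); exact: cvg_snd.
  - by apply: (cvg_comp _ _ (cgamma t)); exact: cvg_snd.
rewrite /Rintegral (@continuous_FTC2 _ f (F \o gamma)) //.
- split=> [t t01||].
  + by have [] := dFg t (subset_itv_oo_cc t01).
  + by apply/cvg_at_right_filter/cFg; rewrite in_itv/= lexx ler01.
  + by apply/cvg_at_left_filter/cFg; rewrite in_itv/= lexx ler01.
- move=> t t01; rewrite derive1E.
  by have [_ ->] := dFg t (subset_itv_oo_cc t01).
Qed.

End Convex.

(** * Calculus in null coordinates *)

Section NullCoordinates.
Context {R : realType}.
Implicit Types (z h : R * R) (F G : R * R -> R).

(** The number with null components [a] and [b], that is
[a (1 + j) / 2 + b (1 - j) / 2]. *)
Definition of_null (a b : R) : R * R := ((a + b) / 2, (a - b) / 2).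

(** [Fu] and [Fv] are the partial derivatives of [F] with respect to the null
coordinates [h.1 + h.2] and [h.1 - h.2]. *)
Definition null_partials F z (Fu Fv : R) : Prop :=
  is_diff z F (fun h => Fu * (h.1 + h.2) + Fv * (h.1 - h.2)).

Lemma of_nullE z : z = of_null (z.1 + z.2) (z.1 - z.2).
Proof. by rewrite {1}[z]surjective_pairing; congr (_, _); field. Qed.

Lemma pcmul_of_null a b c d :
  pcmul (of_null a b) (of_null c d) = of_null (a * c) (b * d).
Proof. by congr (_, _); rewrite /=; field. Qed.

Lemma pcj_of_null a b : pcmul pcj (of_null a b) = of_null a (- b).
Proof. by congr (_, _); rewrite /=; field. Qed.

Lemma pcconj_of_null a b : pcconj (of_null a b) = of_null b a.
Proof. by congr (_, _); rewrite /=; field. Qed.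

Lemma pcnormsq_of_null a b : pcnormsq (of_null a b) = a * b.
Proof. by rewrite /pcnormsq /pcre /=; field. Qed.

Lemma pcsq_of_null a b : pcsq (of_null a b) = of_null (a ^+ 2) (b ^+ 2).
Proof. by rewrite /pcsq pcmul_of_null !expr2. Qed.

Lemma pcone_of_null : pcone = of_null 1 1 :> R * R.
Proof. by rewrite /pcone; congr (_, _); field. Qed.

Lemma scale_of_null k a b : k *: of_null a b = of_null (k * a) (k * b).
Proof. by congr (_, _); rewrite /= /GRing.scale /=; field. Qed.

Lemma add_of_null a b c d : of_null a b + of_null c d = of_null (a + c) (b + d).
Proof. by congr (_, _); rewrite /=; field. Qed.

Lemma opp_of_null a b : - of_null a b = of_null (- a) (- b).
Proof. by congr (_, _); rewrite /=; field. Qed.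

Lemma pcre_of_null a b h :
  pcre (pcmul (of_null a b) h) = a / 2 * (h.1 + h.2) + b / 2 * (h.1 - h.2).
Proof. by rewrite /pcre /=; field. Qed.

Lemma null_partials_eq F z a b a' b' : null_partials F z a b ->
  a = a' -> b = b' -> null_partials F z a' b'.
Proof. by move=> hF <- <-. Qed.

Lemma null_partials_cst c z : null_partials (fun=> c) z 0 0.
Proof.
apply: (is_diff_eq (is_diff_cst c z)).
by apply/funext => h; rewrite !mul0r addr0.
Qed.

Lemma null_partialsD F G z a b c d : null_partials F z a b ->
  null_partials G z c d -> null_partials (fun z => F z + G z) z (a + c) (b + d).
Proof.
move=> hF hG; apply: (is_diff_eq (is_diffD hF hG)).
by apply/funext => h; rewrite fctE /=; ring.
Qed.

Lemma null_partialsM F G z a b c d : null_partials F z a b ->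
  null_partials G z c d ->
  null_partials (fun z => F z * G z) z (a * G z + F z * c) (b * G z + F z * d).
Proof.
move=> hF hG; apply: (is_diff_eq (is_diffM hF hG)).
by apply/funext => h; rewrite !fctE /GRing.scale /=; ring.
Qed.

Lemma null_partials_comp (k : R -> R) dk F z a b : is_derive (F z) 1 k dk ->
  null_partials F z a b -> null_partials (fun z => k (F z)) z (dk * a) (dk * b).
Proof.
move=> [/derivable1_diffP dk1 ek] hF.
have hk : is_diff (F z) k (fun x => x * dk).
  constructor=> //; apply/funext => x.
  by rewrite -ek (deriveE _ dk1) -[x in LHS]mulr1 -[x * 1]/(x *: 1) linearZ.
apply: (is_diff_eq (is_diff_comp hF hk)).
by apply/funext => h /=; ring.
Qed.

Lemma null_partialsN F z a b : null_partials F z a b ->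
  null_partials (fun z => - F z) z (- a) (- b).
Proof.
move=> hF; apply: (is_diff_eq (is_diffN hF)).
by apply/funext => h; rewrite fctE /=; ring.
Qed.

Lemma null_partialsV F z a b : F z != 0 -> null_partials F z a b ->
  null_partials (fun z => (F z)^-1) z (- a / F z ^+ 2) (- b / F z ^+ 2).
Proof.
move=> F0 hF; have dV : is_derive (F z) 1 GRing.inv (- (F z) ^- 2).
  constructor; first exact/diff_derivable/differentiable_Rinv.
  by rewrite (deriveE _ (differentiable_Rinv F0)) diff_Rinv//= [LHS]mulr1.
by apply: (null_partials_eq (null_partials_comp dV hF)); field.
Qed.

Lemma null_partials_u z : null_partials (fun z => z.1 + z.2) z 1 0.
Proof.
pose l : {linear (R * R)%type -> R} :=
  (fst : {linear (R * R)%type -> R}) \+ (snd : {linear (R * R)%type -> R}).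
have cl : continuous l by move=> x; apply: cvgD; [exact: cvg_fst|exact: cvg_snd].
constructor; first exact: (@linear_differentiable _ _ _ l).
by rewrite (@diff_lin _ _ _ l)//; apply/funext => h /=; ring.
Qed.

Lemma null_partials_v z : null_partials (fun z => z.1 - z.2) z 0 1.
Proof.
pose l : {linear (R * R)%type -> R} :=
  (fst : {linear (R * R)%type -> R}) \- (snd : {linear (R * R)%type -> R}).
have cl : continuous l by move=> x; apply: cvgB; [exact: cvg_fst|exact: cvg_snd].
constructor; first exact: (@linear_differentiable _ _ _ l).
by rewrite (@diff_lin _ _ _ l)//; apply/funext => h /=; ring.
Qed.

Lemma derive_of_null a b z au av bu bv h :
  null_partials a z au av -> null_partials b z bu bv ->
  'D_h (fun z => of_null (a z) (b z)) z =
  of_null (au * (h.1 + h.2) + av * (h.1 - h.2)) (bu * (h.1 + h.2) + bv * (h.1 - h.2)).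
Proof.
move=> ha hb.
have hc := null_partials_cst 2^-1 z.
have h1 := null_partialsM (null_partialsD ha hb) hc.
have h2 := null_partialsM (null_partialsD ha (null_partialsN hb)) hc.
have [dp ep] := is_diff_pair h1 h2.
by rewrite (deriveE _ dp) ep /of_null; congr (_, _); rewrite /=; field.
Qed.

Lemma d_z_of_null a b z au av bu bv :
  null_partials a z au av -> null_partials b z bu bv ->
  d_z (fun z => of_null (a z) (b z)) z = of_null au bv.
Proof.
move=> ha hb; rewrite /d_z !(derive_of_null _ ha hb) /= pcj_of_null add_of_null scale_of_null.
by congr of_null; field.
Qed.

Lemma d_zbar_of_null a b z au av bu bv :
  null_partials a z au av -> null_partials b z bu bv ->
  d_zbar (fun z => of_null (a z) (b z)) z = of_null av bu.
Proof.
move=> ha hb; rewrite /d_zbar !(derive_of_null _ ha hb) /= pcj_of_null opp_of_null.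
rewrite add_of_null scale_of_null.
by congr of_null; field.
Qed.

Lemma d_zbar_near (g k : R * R -> R * R) z :
  (\near z, g z = k z) -> d_zbar g z = d_zbar k z.
Proof. by move=> gk; rewrite /d_zbar !(near_eq_derive _ gk). Qed.

End NullCoordinates.

(** * Regularity of solutions of linear differential equations *)

Section Primitive.
Context {R : realType}.

Lemma near_open (V : topologicalType) (p : V) (P : V -> Prop) :
  (\near p, P p) -> exists U, [/\ open U, U p & forall x, U x -> P x].
Proof.
move=> nP; exists [set x | P x]°; split; [exact: open_interior|exact: nP|].
by move=> x /interior_subset.
Qed.

Lemma smooth_at_primitive (F dF : R -> R) (x0 : R) : smooth_at x0 dF ->
  (\forall x \near x0, is_derive (x : R) 1 F (dF x)) -> smooth_at x0 F.
Proof.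
move=> [U [oU Ux sdF]] /near_open[U' [oU' Ux' hF]].
exists (U `&` U'); split=> //; first exact: openI.
move=> k; apply: class_CS.
apply: (@class_C_derive1 _ k _ F dF); first exact: openI.
  by move=> x [_ /hF].
by apply: class_C_sub (sdF k) => x [].
Qed.

(** Bootstrapping: [C^k] solutions have [C^k] derivatives. *)
Lemma smooth_at_linear_system (H X Y : R -> R) (x0 : R) : smooth_at x0 H ->
  (\forall x \near x0, is_derive (x : R) 1 Y (- X x)) ->
  (\forall x \near x0, is_derive (x : R) 1 X (- H x * Y x)) ->
  smooth_at x0 X /\ smooth_at x0 Y.
Proof.
move=> [U [oU Ux sH]] /near_open[U' [oU' Ux' hY]] /near_open[U'' [oU'' Ux'' hX]].
pose W := U `&` U' `&` U''.
have oW : open W by apply: openI => //; exact: openI.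
have sHW k : class_C k W H by apply: class_C_sub (sH k) => x [[]].
have mul k (F G : R -> R) : class_C k W F -> class_C k W G ->
    class_C k W (fun x => F x * G x) by exact: class_CM.
have opp k (F : R -> R) : class_C k W F -> class_C k W (fun x => - F x).
  move=> hF; apply: (class_C_ext oW _ (mul k (fun=> -1) F (class_C_cst k W (-1 : R)) hF)).
  by move=> x _; rewrite mulN1r.
suff s k : class_C k W X /\ class_C k W Y.
  by split; exists W; split=> // k; have [] := s k.
elim: k => [|k [IHX IHY]].
  by split=> x [[_ U'x] U''x];
    [have [/derivable1_diffP + _] := hX x U''x|have [/derivable1_diffP + _] := hY x U'x];
    exact: differentiable_continuous.
split.
- apply: (@class_C_derive1 _ k _ X (fun x => - H x * Y x)) => //.
    by move=> x [_ /hX].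
  exact/mul/IHY/opp.
- apply: (@class_C_derive1 _ k _ Y (fun x => - X x)) => //.
    by move=> x [[_ /hY]].
  exact: opp.
Qed.

End Primitive.

(** * The harmonic map and the surface of a Riccati equation *)

Section Surface.
Context {R : realType}.
Context (H K L M X1 Y1 X2 Y2 : R -> R).
Implicit Types (z : R * R).

(** [(X1, Y1)] and [(X2, Y2)] solve the linear system [Y' = - X], [X' = - H Y] in
the null coordinate [u]; the solution of the Riccati equation is the quotient of
their combination with the second null coordinate [v] as coefficient. *)
Definition sol_num z := X1 (z.1 + z.2) + (z.1 - z.2) * X2 (z.1 + z.2).
Definition sol_den z := Y1 (z.1 + z.2) + (z.1 - z.2) * Y2 (z.1 + z.2).
Definition riccati z := sol_num z / sol_den z.
Definition riccati_v z :=
  (X2 (z.1 + z.2) * sol_den z - sol_num z * Y2 (z.1 + z.2)) / sol_den z ^+ 2.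
(** The null components of [g] are [a = u + 1 / w] and [b = - 1 / u]. *)
Definition gauss z := of_null (z.1 + z.2 + (riccati z)^-1) (- (z.1 + z.2)^-1).
Definition surface z := ruled K L M (z.1 + z.2, riccati z).

Definition derivatives (u : R) :=
  [/\ is_derive u 1 K (H u), is_derive u 1 L (u ^+ 2 * H u) &
      is_derive u 1 M (H u * (u ^+ 2 * K u - u - L u))] /\
  [/\ is_derive u 1 Y1 (- X1 u), is_derive u 1 Y2 (- X2 u),
      is_derive u 1 X1 (- H u * Y1 u) & is_derive u 1 X2 (- H u * Y2 u)].

Definition regular z :=
  [/\ z.1 + z.2 != 0, sol_den z != 0, sol_num z != 0, derivatives (z.1 + z.2) &
      smooth_at (z.1 + z.2) H].

Section AtRegular.
Context (z : R * R) (zreg : regular z).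
Let u := z.1 + z.2.
Let w := riccati z.
Let wv := riccati_v z.

Let u0 : u != 0. Proof. by case: zreg. Qed.
Let d0 : sol_den z != 0. Proof. by case: zreg. Qed.
Let n0 : sol_num z != 0. Proof. by case: zreg. Qed.
Let w0 : w != 0. Proof. by rewrite mulf_neq0 ?invr_neq0. Qed.
Let hu : null_partials (fun z => z.1 + z.2) z 1 0. Proof. exact: null_partials_u. Qed.
Let hv : null_partials (fun z => z.1 - z.2) z 0 1. Proof. exact: null_partials_v. Qed.

Lemma null_partials_riccati : null_partials riccati z (w ^+ 2 - H u) wv.
Proof.
have [_ _ _ [_ [dY1 dY2 dX1 dX2]] _] := zreg.
have hn : null_partials sol_num z (- H u * sol_den z) (X2 u).
  apply: (null_partials_eq (null_partialsD (null_partials_comp dX1 hu)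
    (null_partialsM hv (null_partials_comp dX2 hu)))); rewrite /sol_den -/u; ring.
have hd : null_partials sol_den z (- sol_num z) (Y2 u).
  apply: (null_partials_eq (null_partialsD (null_partials_comp dY1 hu)
    (null_partialsM hv (null_partials_comp dY2 hu)))); rewrite /sol_num -/u; ring.
apply: (null_partials_eq (null_partialsM hn (null_partialsV d0 hd))).
  by rewrite /w /riccati; field.
by rewrite /wv /riccati_v -/u; field.
Qed.

Let hw := null_partials_riccati.

Let ha : null_partials (fun z => z.1 + z.2 + (riccati z)^-1) z
  (H u / w ^+ 2) (- wv / w ^+ 2).
Proof.
by apply: (null_partials_eq (null_partialsD hu (null_partialsV w0 hw))); rewrite -/w; field.
Qed.

Let hb : null_partials (fun z => - (z.1 + z.2)^-1) z (u ^- 2) 0.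
Proof.
by apply: (null_partials_eq (null_partialsN (null_partialsV u0 hu))); rewrite -/u; field.
Qed.

Lemma d_z_gauss : d_z gauss z = of_null (H u / w ^+ 2) 0.
Proof. exact: d_z_of_null ha hb. Qed.

Lemma d_zbar_gauss : d_zbar gauss z = of_null (- wv / w ^+ 2) (u ^- 2).
Proof. exact: d_zbar_of_null ha hb. Qed.

Lemma one_plus_pcnormsq_gauss : 1 + pcnormsq (gauss z) = - (u * w)^-1.
Proof. by rewrite pcnormsq_of_null -/u -/w; field; rewrite u0 w0. Qed.

Lemma omega_hat_gauss : omega_hat gauss z = of_null (- w ^+ 2) (- u ^+ 2 * wv).
Proof.
rewrite /omega_hat one_plus_pcnormsq_gauss.
have -> : (fun z => pcconj (gauss z)) =
    fun z => of_null (- (z.1 + z.2)^-1) (z.1 + z.2 + (riccati z)^-1).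
  by apply/funext => y; rewrite pcconj_of_null.
rewrite (d_z_of_null hb ha) pcj_of_null opp_of_null scale_of_null.
by congr of_null; field; rewrite u0 w0.
Qed.

(** The function differentiated here is [d_z g] by [d_z_gauss]. *)
Lemma d_zbar_d_z_gauss :
  d_zbar (fun z => of_null (H (z.1 + z.2) / riccati z ^+ 2) 0) z =
  of_null (- 2 * H u * wv / w ^+ 3) 0.
Proof.
have [_ _ _ _ /smooth_at_differentiable /derivable1_diffP dH] := zreg.
have hH := null_partials_comp (derivableP dH) hu.
have hw2 : null_partials (fun z => riccati z ^+ 2) z _ _ := null_partialsM hw hw.
have w20 : riccati z ^+ 2 != 0 by rewrite expf_neq0.
rewrite (d_zbar_of_null (null_partialsM hH (null_partialsV w20 hw2)) (null_partials_cst 0 z)).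
by rewrite -/w -/u; congr of_null; field.
Qed.

Let hp : null_partials
  (fun z => - (z.1 + z.2) - (z.1 + z.2) ^+ 2 * riccati z - L (z.1 + z.2))
  z (- (1 + u * w) ^+ 2) (- u ^+ 2 * wv).
Proof.
have [_ _ _ [[_ dL _] _] _] := zreg.
have h := null_partialsD (null_partialsD (null_partialsN hu)
  (null_partialsN (null_partialsM (null_partialsM hu hu) hw)))
  (null_partialsN (null_partials_comp dL hu)).
by apply: (null_partials_eq h); rewrite -/w -/u; ring.
Qed.

Let hq : null_partials (fun z => - riccati z - K (z.1 + z.2)) z (- w ^+ 2) (- wv).
Proof.
have [_ _ _ [[dK _ _] _] _] := zreg.
have h := null_partialsD (null_partialsN hw) (null_partialsN (null_partials_comp dK hu)).
by apply: (null_partials_eq h); rewrite -/w -/u; ring.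
Qed.

Let hc : null_partials (fun=> 2^-1) z 0 0. Proof. exact: null_partials_cst. Qed.

Lemma null_partials_surface1 : null_partials (fun z => (surface z).1.1) z
  (- ((1 + u * w) ^+ 2 + w ^+ 2) / 2) (- (u ^+ 2 + 1) * wv / 2).
Proof.
by apply: (null_partials_eq (null_partialsM (null_partialsD hp hq) hc));
  rewrite /=; field.
Qed.

Lemma null_partials_surface2 : null_partials (fun z => (surface z).1.2) z
  (- ((1 + u * w) ^+ 2 - w ^+ 2) / 2) (- (u ^+ 2 - 1) * wv / 2).
Proof.
by apply: (null_partials_eq (null_partialsM (null_partialsD hp (null_partialsN hq)) hc));
  rewrite /=; field.
Qed.

Lemma null_partials_surface3 : null_partials (fun z => (surface z).2) z
  (K u * (1 + u * w) ^+ 2 - L u * w ^+ 2) ((K u * u ^+ 2 - L u) * wv).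
Proof.
have [_ _ _ [[dK dL dM] _] _] := zreg.
have h := null_partialsD (null_partialsD
  (null_partialsM (null_partials_comp dK hu)
    (null_partialsD hu (null_partialsM (null_partialsM hu hu) hw)))
  (null_partialsN (null_partialsM (null_partials_comp dL hu) hw)))
  (null_partials_comp dM hu).
by apply: (null_partials_eq h); rewrite -/w -/u; ring.
Qed.

End AtRegular.
End Surface.

(** * Minimal surfaces with prescribed singularities *)

Definition realizable {R : realType} (X : R * R -> R * R * R) : Prop :=
  exists (tau : R) (D : set (paracomplex R))
         (g : paracomplex R -> paracomplex R)
         (f : paracomplex R -> R * R * R) (p : paracomplex R),
    tau != 0 /\
    [/\ domain D, simply_connected D, lorentz_harmonic D g & D p] /\
    minimal_surface tau D g f /\
    A_equivalent f p X (0, 0).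

Section Realization.
Context {R : realType}.
Context (H K L M X1 Y1 X2 Y2 : R -> R).
Implicit Types (z : R * R).

Local Notation w := (riccati X1 Y1 X2 Y2).
Local Notation wv := (riccati_v X1 Y1 X2 Y2).
Local Notation g := (gauss X1 Y1 X2 Y2).
Local Notation f := (surface K L M X1 Y1 X2 Y2).
Local Notation reg := (regular H K L M X1 Y1 X2 Y2).
Local Notation denw := (sol_den Y1 Y2).
Local Notation numw := (sol_num X1 X2).

Definition smooth_data (u : R) :=
  [/\ smooth_at u K, smooth_at u L, smooth_at u X1 & smooth_at u X2] /\
  smooth_at u Y1 /\ smooth_at u Y2.

Lemma smooth_at_riccati z : denw z != 0 -> smooth_data (z.1 + z.2) ->
  smooth_at z w /\ smooth_at z wv.
Proof.
move=> d0 [[_ _ s1 s2] [t1 t2]].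
have su : smooth_at z (fun z => z.1 + z.2) by smooth_closure.
have sv : smooth_at z (fun z => z.1 - z.2) by smooth_closure.
have c (k : R -> R) : smooth_at (z.1 + z.2) k -> smooth_at z (fun z => k (z.1 + z.2)).
  by move=> sk; exact: (@smooth_at_comp1 _ _ _ k (fun z => z.1 + z.2)).
have sn : smooth_at z numw.
  by apply: smooth_atD; [exact: c|apply: smooth_atM => //; exact: c].
have sd : smooth_at z denw.
  by apply: smooth_atD; [exact: c|apply: smooth_atM => //; exact: c].
split; first by apply: smooth_atM => //; exact: smooth_atV.
apply: smooth_atM; last by apply: smooth_atV; [rewrite expf_neq0|exact: smooth_atX].
by apply: smooth_atB; apply: smooth_atM => //; exact: c.
Qed.

Lemma smooth_at_gauss z : z.1 + z.2 != 0 -> w z != 0 -> smooth_at z w ->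
  smooth_at z g.
Proof. by move=> u0 w0 sw; rewrite /gauss /of_null; smooth_closure. Qed.

Lemma lorentz_harmonic_gauss D : open D -> (forall z, D z -> reg z) ->
  smooth_on D g -> lorentz_harmonic D g.
Proof.
move=> oD hD sg; split=> // z Dz; have zreg := hD z Dz;
  have [u0 d0 n0 _ _] := zreg; have w0 : w z != 0 by rewrite mulf_neq0 ?invr_neq0.
  apply/eqP => e; have := one_plus_pcnormsq_gauss zreg.
  rewrite e subrr => /esym/eqP; rewrite oppr_eq0 invr_eq0 mulf_eq0.
  by rewrite (negbTE u0) (negbTE w0).
have nD : \forall y \near z, d_z g y = of_null (H (y.1 + y.2) / w y ^+ 2) 0.
  by near=> y; apply: (@d_z_gauss _ _ K L M); apply: hD; near: y; exact: open_nbhs_nbhs.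
rewrite (d_zbar_near nD) (d_zbar_d_z_gauss zreg) (d_z_gauss zreg) (d_zbar_gauss zreg).
rewrite (one_plus_pcnormsq_gauss zreg) pcconj_of_null !pcmul_of_null scale_of_null.
rewrite opp_of_null add_of_null (_ : 0 = of_null 0 0).
  2: by rewrite /of_null; congr (_, _); field.
by congr of_null; field; rewrite ?w0 ?u0.
Unshelve. all: by end_near. Qed.

(** The integrands of the three coordinates.  Their null components are twice the
partial derivatives of the coordinates of the surface; in the third one this
uses the closed forms of the first two. *)
Let form1 z := of_null (((z.1 + z.2 + (w z)^-1) ^+ 2 + 1) * (- w z ^+ 2))
  (((- (z.1 + z.2)^-1) ^+ 2 + 1) * (- (z.1 + z.2) ^+ 2 * wv z)).
Let form2 z := of_null (((z.1 + z.2 + (w z)^-1) ^+ 2 - 1) * (- w z ^+ 2))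
  (- ((- (z.1 + z.2)^-1) ^+ 2 - 1) * (- (z.1 + z.2) ^+ 2 * wv z)).
Let form3 z := let u := z.1 + z.2 in
  of_null (2 * (K u * (1 + u * w z) ^+ 2 - L u * w z ^+ 2))
          (2 * ((K u * u ^+ 2 - L u) * wv z)).

Lemma form1E z : reg z ->
  pcmul (pcsq (g z) + pcone) (omega_hat g z) = form1 z.
Proof.
move=> zreg; rewrite (omega_hat_gauss zreg) pcsq_of_null pcone_of_null.
by rewrite add_of_null pcmul_of_null.
Qed.

Lemma form2E z : reg z ->
  pcmul (pcmul pcj (pcsq (g z) - pcone)) (omega_hat g z) = form2 z.
Proof.
move=> zreg; rewrite (omega_hat_gauss zreg) pcsq_of_null pcone_of_null.
by rewrite opp_of_null add_of_null pcj_of_null pcmul_of_null.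
Qed.

Lemma form3E z : reg z ->
  pcmul (2 *: g z - (2 * (f z).1.2) *: (pcsq (g z) + pcone)
    + (2 * (f z).1.1) *: pcmul pcj (pcsq (g z) - pcone)) (omega_hat g z) = form3 z.
Proof.
move=> zreg; have [u0 d0 n0 _ _] := zreg.
have w0 : w z != 0 by rewrite mulf_neq0 ?invr_neq0.
rewrite (omega_hat_gauss zreg) pcsq_of_null pcone_of_null !opp_of_null.
rewrite !add_of_null pcj_of_null !scale_of_null opp_of_null !add_of_null pcmul_of_null.
rewrite /form3 /surface /ruled /=.
move: (w z) w0 (wv z) (z.1 + z.2) u0 => s s0 sv u u0.
by congr of_null; field; rewrite ?s0 ?u0.
Qed.

Lemma minimal_surface_gauss D : open D ->
  (forall z, D z -> reg z /\ smooth_data (z.1 + z.2)) -> minimal_surface 2 D g f.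
Proof.
move=> oD hD.
have [hreg hsm] : (forall z, D z -> reg z) /\ (forall z, D z -> smooth_data (z.1 + z.2)).
  by split=> z /hD[].
(* an integrand is continuous since it agrees with a smooth map on the open [D] *)
have congD (phi psi : R * R -> R * R) : (forall z, D z -> psi z = phi z) ->
    (forall z, D z -> smooth_at z psi) -> forall z, D z -> {for z, continuous phi}.
  move=> e s z Dz; apply: smooth_at_continuous; apply: smooth_at_near_eq (s z Dz).
  by near=> y; apply: e; near: y; exact: open_nbhs_nbhs.
have w0 z : D z -> w z != 0.
  by move=> /hreg[_ d0 n0 _ _]; rewrite mulf_neq0 ?invr_neq0.
have sw z : D z -> smooth_at z w /\ smooth_at z wv.
  by move=> Dz; apply: smooth_at_riccati (hsm z Dz); have [_] := hreg z Dz.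
have c z (k : R -> R) : smooth_at (z.1 + z.2) k -> smooth_at z (fun z => k (z.1 + z.2)).
  move=> sk; apply: (@smooth_at_comp1 _ _ _ k (fun z => z.1 + z.2)) => //.
  by smooth_closure.
exists (fun z => (f z).1.1), (fun z => (f z).1.2), (fun z => (f z).2); split.
- apply: re_integral_primitive.
    apply: (congD _ form1) => z Dz; first by rewrite form1E//; exact: hreg.
    have [s1 s2] := sw z Dz; have [u0 _ _ _ _] := hreg z Dz; have wz := w0 z Dz.
    by rewrite /form1 /of_null; smooth_closure.
  move=> z Dz; have zreg := hreg z Dz; have [u0 _ _ _ _] := zreg; have wz := w0 z Dz.
  apply: (is_diff_eq (null_partials_surface1 zreg)); apply/funext => h.
  by rewrite form1E// pcre_of_null; field; rewrite ?wz ?u0.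
- apply: re_integral_primitive.
    apply: (congD _ form2) => z Dz; first by rewrite form2E//; exact: hreg.
    have [s1 s2] := sw z Dz; have [u0 _ _ _ _] := hreg z Dz; have wz := w0 z Dz.
    by rewrite /form2 /of_null; smooth_closure.
  move=> z Dz; have zreg := hreg z Dz; have [u0 _ _ _ _] := zreg; have wz := w0 z Dz.
  apply: (is_diff_eq (null_partials_surface2 zreg)); apply/funext => h.
  by rewrite form2E// pcre_of_null; field; rewrite ?wz ?u0.
- apply: re_integral_primitive.
    apply: (congD _ form3) => z Dz; first by rewrite form3E//; exact: hreg.
    have [s1 s2] := sw z Dz; have [[sK sL _ _] _] := hsm z Dz.
    have sK' := c _ _ sK; have sL' := c _ _ sL.
    by rewrite /form3 /of_null /=; smooth_closure.
  move=> z Dz; have zreg := hreg z Dz.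
  apply: (is_diff_eq (null_partials_surface3 zreg)); apply/funext => h.
  by rewrite form3E// pcre_of_null; field.
- by move=> z Dz; rewrite divff ?pnatr_eq0// !mul1r.
Unshelve. all: by end_near. Qed.

Context (sH : smooth_at (1 : R) H).
Context (dE : \forall u \near (1 : R), derivatives H K L M X1 Y1 X2 Y2 u).
Context (init : [/\ X1 1 = - 2^-1, Y1 1 = 1, X2 1 = 1 & Y2 1 = 0]).

Local Notation p0 := ((2^-1, 2^-1) : R * R).

Let p0u : p0.1 + p0.2 = 1. Proof. by rewrite /=; field. Qed.

Lemma smooth_data1 : smooth_data 1.
Proof.
have n (P : R -> Prop) : (forall u, derivatives H K L M X1 Y1 X2 Y2 u -> P u) ->
    \forall u \near (1 : R), P u by move=> h; apply: filterS dE.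
have [s1 t1] : smooth_at (1 : R) X1 /\ smooth_at (1 : R) Y1.
  by apply: (smooth_at_linear_system sH); apply: n => u [_ []].
have [s2 t2] : smooth_at (1 : R) X2 /\ smooth_at (1 : R) Y2.
  by apply: (smooth_at_linear_system sH); apply: n => u [_ []].
split=> //; split=> //.
  by apply: (smooth_at_primitive sH); apply: n => u [[]].
have s2H : smooth_at (1 : R) (fun u => u ^+ 2 * H u) by smooth_closure.
by apply: (smooth_at_primitive s2H); apply: n => u [[]].
Qed.

Lemma riccati_base : [/\ denw p0 = 1, numw p0 = - 2^-1 & w p0 = - 2^-1].
Proof.
have [x1 y1 x2 y2] := init.
have d : denw p0 = 1 by rewrite /sol_den p0u y1 y2 mulr0 addr0.
have n : numw p0 = - 2^-1 by rewrite /sol_num p0u x1 x2 subrr mul0r addr0.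
by split=> //; rewrite /riccati d n divr1.
Qed.

Lemma near_p0 (P : R -> Prop) : (\forall u \near (1 : R), P u) ->
  \forall z \near p0, P (z.1 + z.2).
Proof.
have su : smooth_at p0 (fun z => z.1 + z.2) by smooth_closure.
by rewrite -[in X in X -> _]p0u; exact: (smooth_at_continuous su).
Qed.

(** At the base point [u = 1], [v = 0] the initial conditions give [Y = 1] and
[X = - 1/2], and nonvanishing persists nearby. *)
Lemma near_regular : \forall z \near p0, reg z /\ smooth_data (z.1 + z.2).
Proof.
have [[sK sL s1 s2] [t1 t2]] := smooth_data1.
have [d n _] := riccati_base.
have su : smooth_at p0 (fun z => z.1 + z.2) by smooth_closure.
have sv : smooth_at p0 (fun z => z.1 - z.2) by smooth_closure.
have c (k : R -> R) : smooth_at (1 : R) k -> smooth_at p0 (fun z => k (z.1 + z.2)).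
  move=> sk; apply: (@smooth_at_comp1 _ _ _ k (fun z => z.1 + z.2)) => //.
  by rewrite p0u.
have sn : smooth_at p0 numw.
  by apply: smooth_atD; [exact: c|apply: smooth_atM => //; exact: c].
have sd : smooth_at p0 denw.
  by apply: smooth_atD; [exact: c|apply: smooth_atM => //; exact: c].
have u0 : p0.1 + p0.2 != 0 by rewrite p0u oner_eq0.
have d0 : denw p0 != 0 by rewrite d oner_eq0.
have n0 : numw p0 != 0 by rewrite n oppr_eq0 invr_eq0 pnatr_eq0.
have N1 := smooth_at_near_neq0 su u0.
have N2 := smooth_at_near_neq0 sd d0.
have N3 := smooth_at_near_neq0 sn n0.
have N4 := near_p0 dE.
have N5 := near_p0 (smooth_at_near sH).
have N6 := near_p0 (smooth_at_near sK).
have N7 := near_p0 (smooth_at_near sL).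
have N8 := near_p0 (smooth_at_near s1).
have N9 := near_p0 (smooth_at_near s2).
have N10 := near_p0 (smooth_at_near t1).
have N11 := near_p0 (smooth_at_near t2).
near=> z; split; first by split;
  [exact: (near N1 z)|exact: (near N2 z)|exact: (near N3 z)|
   exact: (near N4 z)|exact: (near N5 z)].
by split; [split;
  [exact: (near N6 z)|exact: (near N7 z)|exact: (near N8 z)|exact: (near N9 z)]|
  split; [exact: (near N10 z)|exact: (near N11 z)]].
Unshelve. all: by end_near. Qed.

(** For fixed [u] the value of [w] is a linear fractional function of [v], whence
the inverse chart. *)
Definition ruling_chart z : R * R := (z.1 + z.2, w z).
Definition ruling_chart_inv (x : R * R) : R * R :=
  of_null x.1 ((X1 x.1 - x.2 * Y1 x.1) / (x.2 * Y2 x.1 - X2 x.1)).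

Lemma diffeo_germ_ruling_chart : diffeo_germ ruling_chart ruling_chart_inv p0 (1, - 2^-1).
Proof.
have [[sK sL s1 s2] [t1 t2]] := smooth_data1.
have [x1 y1 x2 y2] := init.
have [d n e] := riccati_base.
have d0 : denw p0 != 0 by rewrite d oner_eq0.
have sd1 : smooth_data (p0.1 + p0.2) by rewrite p0u; exact: smooth_data1.
have [sw _] := smooth_at_riccati d0 sd1.
pose q : R * R := (1, - 2^-1).
have c (k : R -> R) : smooth_at (1 : R) k -> smooth_at q (fun x => k x.1).
  by move=> sk; apply: smooth_at_comp1 => //; smooth_closure.
have [sx1 sy1 sx2 sy2] := And4 (c _ s1) (c _ t1) (c _ s2) (c _ t2).
pose D (x : R * R) := x.2 * Y2 x.1 - X2 x.1.
have sD : smooth_at q D by rewrite /D; smooth_closure.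
have D0 : D q != 0 by rewrite /D /= x2 y2 mulr0 sub0r oppr_eq0 oner_eq0.
have sv : smooth_at q (fun x => (X1 x.1 - x.2 * Y1 x.1) / D x) by smooth_closure.
have sE : smooth_at q (fun x => Y1 x.1 + (X1 x.1 - x.2 * Y1 x.1) / D x * Y2 x.1) by smooth_closure.
have E0 : Y1 q.1 + (X1 q.1 - q.2 * Y1 q.1) / D q * Y2 q.1 != 0.
  by rewrite /= y1 y2 mulr0 addr0 oner_eq0.
have chart_base : ruling_chart p0 = q by rewrite /ruling_chart p0u e.
apply: diffeo_germ_near.
- by apply: smooth_at_pair => //; smooth_closure.
- by rewrite /ruling_chart_inv /of_null; smooth_closure.
- exact: chart_base.
- have sc : smooth_at p0 ruling_chart by apply: smooth_at_pair => //; smooth_closure.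
  have N1 : \forall z \near p0, D (ruling_chart z) != 0.
    have := smooth_at_near_neq0 sD D0; rewrite -chart_base.
    exact: (smooth_at_continuous sc).
  have N2 := near_regular.
  near=> z; have D1 : D (ruling_chart z) != 0 by exact: (near N1 z).
  have [[u0 d1 n0 _ _] _] : reg z /\ smooth_data (z.1 + z.2) by exact: (near N2 z).
  rewrite [RHS]of_nullE /ruling_chart_inv /=; congr of_null.
  move: D1 d1; rewrite /D /ruling_chart /= /riccati /sol_num /sol_den.
  move: (z.1 + z.2) (z.1 - z.2) => u v D1 d1.
  have D2 : (X1 u + v * X2 u) * Y2 u - X2 u * (Y1 u + v * Y2 u) != 0.
    apply: contra_neq D1 => D2; apply: (mulIf d1).
    by rewrite mul0r -D2; field.
  by field; rewrite d1 mulNr D2.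
have N1 := smooth_at_near_neq0 sD D0.
have N2 := smooth_at_near_neq0 sE E0.
near=> x; have D1 : D x != 0 by exact: (near N1 x).
have E1 : Y1 x.1 + (X1 x.1 - x.2 * Y1 x.1) / D x * Y2 x.1 != 0 by exact: (near N2 x).
rewrite /ruling_chart [RHS]surjective_pairing /riccati /sol_num /sol_den.
pose v := (X1 x.1 - x.2 * Y1 x.1) / D x.
have -> : (ruling_chart_inv x).1 + (ruling_chart_inv x).2 = x.1 by rewrite /=; field.
have -> : (ruling_chart_inv x).1 - (ruling_chart_inv x).2 = v by rewrite /= -/(D x) -/v; field.
congr (_, _); apply: (mulIf E1); rewrite mulfVK//.
move: D1; rewrite /v /D => D1; field; exact: D1.
Unshelve. all: by end_near. Qed.

(** The domain is a ball: being convex it is simply connected, and it can be taken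
inside the neighbourhood where [u], [w] and the denominator do not vanish. *)
Lemma realization (X : R * R -> R * R * R) :
  A_equivalent (ruled K L M) (1, - 2^-1) X (0, 0) ->
  realizable X.
Proof.
move=> AX.
have [d n e] := riccati_base.
have d0 : denw p0 != 0 by rewrite d oner_eq0.
have sd1 : smooth_data (p0.1 + p0.2) by rewrite p0u; exact: smooth_data1.
have [sw _] := smooth_at_riccati d0 sd1.
have sg : smooth_at p0 g.
  by apply: smooth_at_gauss => //; rewrite ?p0u ?oner_eq0// e oppr_eq0 invr_eq0 pnatr_eq0.
case: sg => U [oU Up sU].
have NU : nbhs p0 U by exact: open_nbhs_nbhs.
have [r /= r0 hr] := (nbhs_ballP _ _).1 (filterI NU near_regular).
pose D := ball p0 r.
have oD : open D by exact: ball_open.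
have Dp : D p0 by exact: ballxx.
have sD : segment_closed D by exact: ball_segment_closed.
have hD z : D z -> reg z /\ smooth_data (z.1 + z.2) by move=> /hr[].
exists 2, D, g, f, p0; split; first by rewrite pnatr_eq0.
split; [split=> //|split].
- by split=> //; [exact: segment_closed_connected|exists p0].
- exact: segment_closed_simply_connected.
- apply: lorentz_harmonic_gauss => //; first by move=> z /hD[].
  by move=> k; apply: class_C_sub (sU k) => z /hr[].
- exact: minimal_surface_gauss.
by apply: (A_equivalent_reparam AX diffeo_germ_ruling_chart); near=> z.
Unshelve. all: by end_near. Qed.

End Realization.

(** * Power series with bounded coefficients *)

Section PowerSeries.
Context {R : realType}.
Implicit Types (c : R^nat) (t : R).

Definition psum c t := limn (pseries c t).
Definition shift_coef c n : R := if n is n'.+1 then c n' else 0.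

Lemma pseries_cvg_geometric c (B r t : R) : 0 <= r ->
  (forall n, `|c n| <= B * r ^+ n) -> `|r * t| < 1 ->
  pseries c t @ \oo --> psum c t.
Proof.
move=> r0 cB rt; have B0 : 0 <= B.
  by have := cB 0%N; rewrite expr0 mulr1; apply: le_trans.
suff : cvgn (pseries c t) by [].
apply: normed_cvg; apply: (@series_le_cvg _ _ (geometric B `|r * t|)) => [n|n|n|].
- exact: normr_ge0.
- by rewrite /= mulr_ge0// exprn_ge0.
- rewrite /= normrM [`|r * t|]normrM (ger0_norm r0) exprMn mulrA normrX.
  by rewrite ler_wpM2r// exprn_ge0.
by apply: is_cvg_geometric_series; rewrite normr_id.
Qed.

(** [n + 1 <= 2^n] trades the polynomial growth caused by differentiation for a
smaller radius. *)
Lemma pseries_diffs_bound c (B r : R) : 1 <= r ->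
  (forall n, `|c n| <= B * r ^+ n) ->
  forall n, `|pseries_diffs c n| <= (B * r) * (2 * r) ^+ n.
Proof.
move=> r1 cB n; rewrite /pseries_diffs normrM ger0_norm ?ler0n//.
have h : n.+1%:R <= 2 ^+ n :> R by rewrite -natrX ler_nat ltn_expl.
rewrite (le_trans (ler_pM _ _ h (cB _)))// exprMn exprS le_eqVlt.
by apply/orP; left; apply/eqP; ring.
Qed.

(** The radius [1/8] leaves room for the two differentiations that the termwise
derivation theorem asks for, each of which doubles the growth rate. *)
Lemma psum_derive c (B t : R) : (forall n, `|c n| <= B) -> `|t| < 8^-1 ->
  [/\ pseries c t @ \oo --> psum c t,
      pseries (pseries_diffs c) t @ \oo --> psum (pseries_diffs c) t &
      is_derive t 1 (psum c) (psum (pseries_diffs c) t)].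
Proof.
move=> cB t8.
have b0 n : `|c n| <= B * 1 ^+ n by rewrite expr1n mulr1.
have b1 := pseries_diffs_bound (lexx 1) b0.
have r2 : 1 <= 2 * 1 :> R by lra.
have b2 := pseries_diffs_bound r2 b1.
have small (r s : R) : 0 <= r <= 4 -> `|s| <= 8^-1 -> `|r * s| < 1.
  move=> /andP[r0 r4] s8; rewrite normrM ger0_norm//.
  by rewrite (le_lt_trans (ler_pM _ _ r4 s8))// ltr_pdivrMr// mul1r ltr_nat.
have t8' := ltW t8.
have K8 : `|8^-1 : R| <= 8^-1 by rewrite ger0_norm.
have [s1 s2 s3] : [/\ 0 <= (1 : R) <= 4, 0 <= (2 * 1 : R) <= 4 &
  0 <= (2 * (2 * 1) : R) <= 4] by split; lra.
have [p1 p2 p4] : [/\ 0 <= 1 :> R, 0 <= 2 * 1 :> R & 0 <= 2 * (2 * 1) :> R] by split; lra.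
split.
- exact: pseries_cvg_geometric p1 b0 (small _ _ s1 t8').
- exact: pseries_cvg_geometric p2 b1 (small _ _ s2 t8').
apply: (@pseries_snd_diffs _ _ 8^-1).
- exact: cvgP (pseries_cvg_geometric p1 b0 (small _ _ s1 K8)).
- exact: cvgP (pseries_cvg_geometric p2 b1 (small _ _ s2 K8)).
- exact: cvgP (pseries_cvg_geometric p4 b2 (small _ _ s3 K8)).
- by rewrite [ltRHS]ger0_norm.
Qed.

Lemma pseries_shift c t (l : R) : pseries c t @ \oo --> l ->
  pseries (shift_coef c) t @ \oo --> t * l.
Proof.
move=> cl; rewrite -cvg_shiftS.
rewrite (_ : (fun n => _) = (fun n => t * pseries c t n)); first exact: cvgMr.
apply/funext => n; rewrite /pseries /series /= big_nat_recl//= mul0r add0r mulr_sumr.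
by apply: eq_bigr => i _; rewrite exprS; ring.
Qed.

Lemma pseriesD c c' t (l l' : R) : pseries c t @ \oo --> l ->
  pseries c' t @ \oo --> l' -> pseries (fun n => c n + c' n) t @ \oo --> l + l'.
Proof.
move=> cl cl'; rewrite (_ : pseries _ t = pseries c t \+ pseries c' t).
  exact: cvgD.
apply/funext => n; rewrite /pseries /series /= -big_split/=.
by apply: eq_bigr => i _; rewrite mulrDl.
Qed.

Lemma pseriesZ c a t (l : R) : pseries c t @ \oo --> l ->
  pseries (fun n => a * c n) t @ \oo --> a * l.
Proof.
move=> cl; rewrite (_ : pseries _ t = (fun n => a * pseries c t n)).
  exact: cvgMr.
apply/funext => n; rewrite /pseries /series /= mulr_sumr.
by apply: eq_bigr => i _; rewrite mulrA.
Qed.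

Lemma psum0 c : psum c 0 = c 0%N.
Proof.
apply/cvg_lim => //; rewrite -cvg_shiftS.
rewrite (_ : (fun n => _) = fun=> c 0%N); first exact: cvg_cst.
apply/funext => n; rewrite /pseries /series /= big_nat_recl//= expr0 mulr1.
by rewrite big1 ?addr0// => i _; rewrite expr0n mulr0.
Qed.

Lemma pseries_unique c c' t (l l' : R) : (forall n, c n = c' n) ->
  pseries c t @ \oo --> l -> pseries c' t @ \oo --> l' -> l = l'.
Proof. by move=> /funext -> h h'; exact: cvg_unique h h'. Qed.

End PowerSeries.

(** * The linear system for cuspidal edges and cross caps *)

Section CuspSystem.
Context {R : realType}.
Context (k y0 x0 : R).

(** In the variable [t = u^3 - 1] the system for [Y] and [x = u X] reads
[(1 + t) Y' = - x / 3] and [(1 + t) x' = (x + (1/2 - 2 k (1 + t)) Y) / 3].  The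
state of the recursion is [(Y_n, x_n, Y_(n-1))]. *)
Fixpoint coef n : R * R * R :=
  if n is n'.+1 then
    let: (y, x, y') := coef n' in
    ((- n'%:R * y - x / 3) / n'.+1%:R,
     (- n'%:R * x + (x + (2^-1 - 2 * k) * y - 2 * k * y') / 3) / n'.+1%:R, y)
  else (y0, x0, 0).
Definition ycoef n := (coef n).1.1.
Definition xcoef n := (coef n).1.2.

Lemma coef_shift n : (coef n).2 = shift_coef ycoef n.
Proof. by case: n => //= n; rewrite /ycoef; case: (coef n) => [[]]. Qed.

Lemma ycoefE n : pseries_diffs ycoef n + shift_coef (pseries_diffs ycoef) n = - 3^-1 * xcoef n.
Proof.
have -> : shift_coef (pseries_diffs ycoef) n = n%:R * ycoef n by case: n => //=; rewrite mul0r.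
rewrite /pseries_diffs /xcoef /ycoef /=; case: (coef n) => [[y x] y'] /=.
by rewrite mulrC divfK ?pnatr_eq0//; field.
Qed.

Lemma xcoefE n : pseries_diffs xcoef n + shift_coef (pseries_diffs xcoef) n =
  3^-1 * xcoef n + ((2^-1 - 2 * k) / 3 * ycoef n + - 2 * k / 3 * shift_coef ycoef n).
Proof.
have -> : shift_coef (pseries_diffs xcoef) n = n%:R * xcoef n by case: n => //=; rewrite mul0r.
rewrite -coef_shift /pseries_diffs /xcoef /ycoef /=; case: (coef n) => [[y x] y'] /=.
by rewrite mulrC divfK ?pnatr_eq0//; field.
Qed.

(** The smallness condition on [k] makes the recursion nonexpansive. *)
Lemma coef_bound B n : `|2^-1 - 2 * k| + 2 * `|k| <= 2 -> `|y0| <= B -> `|x0| <= B ->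
  [/\ `|ycoef n| <= B, `|xcoef n| <= B & `|(coef n).2| <= B].
Proof.
move=> k2 y0B x0B; have B0 : 0 <= B by rewrite (le_trans _ y0B).
elim: n => [|n]; first by rewrite normr0.
rewrite /ycoef /xcoef /=; case: (coef n) => [[y x] y'] /= [yB xB y'B].
have nB (s : R) : `|s| <= n.+1%:R * B -> `|s / n.+1%:R| <= B.
  by move=> sB; rewrite normrM normfV normr_nat ler_pdivrMr ?ltr0n// mulrC.
split=> //; apply: nB.
  rewrite (le_trans (ler_normB _ _))// normrM normrN normr_nat -[n.+1%:R]natr1.
rewrite [(n%:R + 1) * _]mulrDl.
  rewrite lerD ?ler_wpM2l// mul1r normrM (ger0_norm (_ : 0 <= 3^-1)) ?invr_ge0//.
  by rewrite ler_pdivrMr// (le_trans xB)// ler_peMr// ler1n.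
rewrite (le_trans (ler_normD _ _))// normrM normrN normr_nat -[n.+1%:R]natr1.
rewrite [(n%:R + 1) * _]mulrDl.
rewrite lerD ?ler_wpM2l// mul1r normrM (ger0_norm (_ : 0 <= 3^-1)) ?invr_ge0//.
rewrite ler_pdivrMr//.
rewrite (le_trans (ler_normB _ _))//.
have h1 : `|(2^-1 - 2 * k) * y| <= `|2^-1 - 2 * k| * B by rewrite normrM ler_wpM2l.
have h2 : `|2 * k * y'| <= 2 * `|k| * B.
  by rewrite !normrM (ger0_norm (_ : 0 <= 2))// ler_wpM2l// mulr_ge0.
have h3 := ler_normD x ((2^-1 - 2 * k) * y).
have h4 : (`|2^-1 - 2 * k| + 2 * `|k|) * B <= 2 * B by rewrite ler_wpM2r.
by move: h1 h2 h3 h4 xB; rewrite mulrDl; lra.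
Qed.

Context (k2 : `|2^-1 - 2 * k| + 2 * `|k| <= 2).

Definition Ycusp u : R := psum ycoef (u ^+ 3 - 1).
Definition Xcusp u : R := psum xcoef (u ^+ 3 - 1) / u.
Definition cuspH (u : R) : R := - (2 * u ^+ 2)^-1 + 2 * k * u.

Lemma psum_system (t : R) : `|t| < 8^-1 ->
  exists dy dx : R, [/\ is_derive t 1 (psum ycoef) dy, is_derive t 1 (psum xcoef) dx,
    (1 + t) * dy = - psum xcoef t / 3 &
    (1 + t) * dx = (psum xcoef t + (2^-1 - 2 * k * (1 + t)) * psum ycoef t) / 3].
Proof.
move=> t8; pose B := Num.max `|y0| `|x0|.
have yB : `|y0| <= B by rewrite le_max lexx.
have xB : `|x0| <= B by rewrite le_max lexx orbT.
have b n := coef_bound n k2 yB xB.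
have [cy cdy dy] := @psum_derive _ ycoef B t (fun n => let: And3 h _ _ := b n in h) t8.
have [cx cdx dx] := @psum_derive _ xcoef B t (fun n => let: And3 _ h _ := b n in h) t8.
exists (psum (pseries_diffs ycoef) t), (psum (pseries_diffs xcoef) t); split=> //.
- have := pseries_unique ycoefE (pseriesD cdy (pseries_shift cdy)) (pseriesZ (a := - 3^-1) cx).
  by move=> e; rewrite mulrDl mul1r e; ring.
have := pseries_unique xcoefE (pseriesD cdx (pseries_shift cdx))
  (pseriesD (pseriesZ (a := 3^-1) cx) (pseriesD (pseriesZ (a := (2^-1 - 2 * k) / 3) cy)
     (pseriesZ (a := - 2 * k / 3) (pseries_shift cy)))).
by move=> e; rewrite mulrDl mul1r e; field.
Qed.

(** The pullback of the power series system by [t = u^3 - 1], for which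
[1 + t = u^3]. *)
Lemma cusp_system : \forall u \near (1 : R),
  is_derive (u : R) 1 Ycusp (- Xcusp u) /\ is_derive u 1 Xcusp (- cuspH u * Ycusp u).
Proof.
have s1 : smooth_at (1 : R) (fun u : R => 8^-1 - (u ^+ 3 - 1)) by smooth_closure.
have s2 : smooth_at (1 : R) (fun u : R => 8^-1 + (u ^+ 3 - 1)) by smooth_closure.
have e1 : 0 < 8^-1 - (1 ^+ 3 - 1) :> R by rewrite expr1n subrr subr0.
have e2 : 0 < 8^-1 + (1 ^+ 3 - 1) :> R by rewrite expr1n subrr addr0.
have N1 := smooth_at_near_gt0 s1 e1.
have N2 := smooth_at_near_gt0 s2 e2.
have N3 : \forall u \near (1 : R), u != 0.
  by apply: smooth_at_near_neq0 (smooth_at_id _) (oner_neq0 _).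
near=> u.
have u0 : u != 0 by exact: (near N3 u).
have t8 : `|u ^+ 3 - 1| < 8^-1.
  have h1 : 0 < 8^-1 - (u ^+ 3 - 1) by exact: (near N1 u).
  have h2 : 0 < 8^-1 + (u ^+ 3 - 1) by exact: (near N2 u).
  by rewrite ltr_norml; apply/andP; split; [rewrite -subr_gt0 opprK addrC|rewrite -subr_gt0].
have [dy [dx [hy hx ey ex]]] := psum_system t8.
have ht : is_derive u 1 (fun u : R => u ^+ 3 - 1) (3 * u ^+ 2).
  have := is_deriveB (is_deriveX 3 (is_derive_id u 1)) (is_derive_cst (1 : R) u 1).
  by rewrite exprfctE subr0 [_ *: 1]mulr1.
pose T (v : R) := v ^+ 3 - 1.
have hY := @is_derive1_comp R (psum ycoef) T u _ _ hy ht.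
have hX := @is_derive1_comp R (psum xcoef) T u _ _ hx ht.
have u3 : u ^+ 3 != 0 by rewrite expf_neq0.
have eu : 1 + (u ^+ 3 - 1) = u ^+ 3 by ring.
rewrite eu in ey ex.
have dyE : dy = - psum xcoef (u ^+ 3 - 1) / 3 / u ^+ 3.
  by rewrite -ey; field.
have dxE : dx = (psum xcoef (u ^+ 3 - 1)
    + (2^-1 - 2 * k * u ^+ 3) * psum ycoef (u ^+ 3 - 1)) / 3 / u ^+ 3.
  by rewrite -ex; field.
split.
  by apply: is_derive_eq hY _; rewrite dyE /Xcusp; field.
have := is_deriveM hX (is_deriveV u0 (is_derive_id u 1)).
move=> h; apply: is_derive_eq h _.
by rewrite dxE /Xcusp /Ycusp /cuspH /= /GRing.scale /=; field.
Unshelve. all: by end_near. Qed.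

Lemma cusp_init : Ycusp 1 = y0 /\ Xcusp 1 = x0.
Proof. by rewrite /Ycusp /Xcusp expr1n subrr !psum0 divr1. Qed.

End CuspSystem.

(** * The three surfaces *)

Section Instances.
Context {R : realType}.

Lemma is_derive_monomial (a : R) n (x : R) :
  is_derive x 1 (fun x => a * x ^+ n) (a * n%:R * x ^+ n.-1).
Proof.
have h := is_deriveM (is_derive_cst (a : R) x 1) (is_deriveX n (is_derive_id x 1)).
move: h; rewrite exprfctE => h; apply: is_derive_eq h _.
by rewrite scaler0 addr0 [_ *: 1]mulr1 /GRing.scale /= mulrA.
Qed.

Lemma is_derive_add (f g : R -> R) (x a b : R) :
  is_derive x 1 f a -> is_derive x 1 g b ->
  is_derive x 1 (fun x => f x + g x) (a + b).
Proof. by move=> hf hg; exact: is_deriveD. Qed.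

Lemma cusp_primitives k (u : R) : u != 0 ->
  [/\ is_derive u 1 (cuspK k) (cuspH k u), is_derive u 1 (cuspL k) (u ^+ 2 * cuspH k u) &
      is_derive u 1 (cuspM k) (cuspH k u * (u ^+ 2 * cuspK k u - u - cuspL k u))].
Proof.
move=> u0; split.
- have u20 : 2 * u ^+ 1 != 0 by rewrite mulf_neq0 ?pnatr_eq0.
  have h := is_derive_add (is_deriveV u20 (is_derive_monomial 2 1 u)) (is_derive_monomial k 2 u).
  apply: is_derive_eq h _.
  by rewrite /cuspH /GRing.scale /=; field.
- have -> : cuspL k = fun u => - 2^-1 * u ^+ 1 + k / 2 * u ^+ 4.
    by apply/funext => x; rewrite /cuspL; field.
  apply: is_derive_eq (is_derive_add (is_derive_monomial _ 1 u) (is_derive_monomial _ 4 u)) _.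
  by rewrite /cuspH /=; field.
- have -> : cuspM k = fun u => - k / 12 * u ^+ 3 + k ^+ 2 / 6 * u ^+ 6.
    by apply/funext => x; rewrite /cuspM; field.
  apply: is_derive_eq (is_derive_add (is_derive_monomial _ 3 u) (is_derive_monomial _ 6 u)) _.
  by rewrite /cuspH /cuspK /cuspL /=; field.
Qed.

Lemma smooth_at_cuspH k : smooth_at (1 : R) (cuspH k).
Proof. by rewrite /cuspH; smooth_closure; rewrite mulf_neq0 ?expf_neq0 ?oner_eq0 ?pnatr_eq0. Qed.

(** The two solutions have initial values [(X, Y) = (- 1/2, 1)] and [(1, 0)]. *)
Lemma cusp_realization k (X : R * R -> R * R * R) :
  `|2^-1 - 2 * k| + 2 * `|k| <= 2 ->
  A_equivalent (ruled (cuspK k) (cuspL k) (cuspM k)) (1, - 2^-1) X (0, 0) ->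
  realizable X.
Proof.
move=> k2 AX.
apply: (@realization _ (cuspH k) (cuspK k) (cuspL k) (cuspM k)
  (Xcusp k 1 (- 2^-1)) (Ycusp k 1 (- 2^-1)) (Xcusp k 0 1) (Ycusp k 0 1)) => //.
- exact: smooth_at_cuspH.
- have N1 := cusp_system 1 (- 2^-1) k2.
  have N2 := cusp_system 0 1 k2.
  have N3 : \forall u \near (1 : R), u != 0.
    by apply: smooth_at_near_neq0 (smooth_at_id _) (oner_neq0 _).
  near=> u; split; first by apply: cusp_primitives; exact: (near N3 u).
  have [a b] : is_derive u 1 (Ycusp k 1 (- 2^-1)) (- Xcusp k 1 (- 2^-1) u) /\
    is_derive u 1 (Xcusp k 1 (- 2^-1)) (- cuspH k u * Ycusp k 1 (- 2^-1) u)
    by exact: (near N1 u).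
  have [c d] : is_derive u 1 (Ycusp k 0 1) (- Xcusp k 0 1 u) /\
    is_derive u 1 (Xcusp k 0 1) (- cuspH k u * Ycusp k 0 1 u) by exact: (near N2 u).
  by split.
- have [e1 e2] := cusp_init k 1 (- 2^-1).
  by have [e3 e4] := cusp_init k 0 1.
Unshelve. all: by end_near. Qed.

(** The system [Y' = - X], [X' = Y / 2] is solved by cosines and sines of
[c (u - 1)] with [c^2 = 1/2]. *)
Lemma swallowtail_realization : realizable (@swallowtail R).
Proof.
pose c : R := Num.sqrt 2^-1.
have c2 : c ^+ 2 = 2^-1 by rewrite sqr_sqrtr.
have c0 : c != 0 by rewrite sqrtr_eq0 -ltNge invr_gt0.
have ci : c^-1 = 2 * c by apply: (mulIf c0); rewrite mulVf// -mulrA -expr2 c2 divff ?pnatr_eq0.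
pose T (u : R) := - c * u ^+ 0 + c * u ^+ 1.
have T1 : T 1 = 0 by rewrite /T !expr1n; ring.
have dT (u : R) : is_derive u 1 T c.
  apply: is_derive_eq (is_derive_add (is_derive_monomial _ 0 u) (is_derive_monomial _ 1 u)) _.
  by rewrite /=; ring.
have dcos (u : R) : is_derive u 1 (fun u => cos (T u)) (- sin (T u) * c).
  exact: (@is_derive1_comp R cos T u _ _ (is_derive_cos (T u)) (dT u)).
have dsin (u : R) : is_derive u 1 (fun u => sin (T u)) (cos (T u) * c).
  exact: (@is_derive1_comp R sin T u _ _ (is_derive_sin (T u)) (dT u)).
have dcomb (a b u : R) : is_derive u 1 (fun u => a * cos (T u) + b * sin (T u))
    (a * (- sin (T u) * c) + b * (cos (T u) * c)).
  exact: is_derive_add.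
apply: (@realization _ (fun=> - 2^-1) (@tailK R) (@tailL R) (@tailM R)
  (fun u => - 2^-1 * cos (T u) + c * sin (T u)) (fun u => 1 * cos (T u) + c * sin (T u))
  (fun u => 1 * cos (T u) + 0 * sin (T u)) (fun u => 0 * cos (T u) + - c^-1 * sin (T u))).
- exact: smooth_at_cst.
- near=> u; split; split.
  + have -> : @tailK R = fun u => - 2^-1 * u ^+ 1 + 0 * u ^+ 0.
      by apply/funext => x; rewrite /tailK; field.
    apply: is_derive_eq (is_derive_add (is_derive_monomial _ 1 u) (is_derive_monomial _ 0 u)) _.
    by rewrite /=; ring.
  + have -> : @tailL R = fun u => - 6^-1 * u ^+ 3 + 0 * u ^+ 0.
      by apply/funext => x; rewrite /tailL; field.
    apply: is_derive_eq (is_derive_add (is_derive_monomial _ 3 u) (is_derive_monomial _ 0 u)) _.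
    by rewrite /=; field.
  + have -> : @tailM R = fun u => 4^-1 * u ^+ 2 + 24^-1 * u ^+ 4.
      by apply/funext => x; rewrite /tailM; field.
    apply: is_derive_eq (is_derive_add (is_derive_monomial _ 2 u) (is_derive_monomial _ 4 u)) _.
    by rewrite /tailK /tailL /=; field.
  + by apply: is_derive_eq (dcomb _ _ u) _; rewrite -c2; ring.
  + by apply: is_derive_eq (dcomb _ _ u) _; field.
  + by apply: is_derive_eq (dcomb _ _ u) _; rewrite -c2; ring.
  + by apply: is_derive_eq (dcomb _ _ u) _; rewrite ci; field.
- by rewrite T1 cos0 sin0; split; ring.
exact: swallowtail_ruled.
Unshelve. all: by end_near. Qed.

End Instances.

Theorem theorem5p3 (R : realType) (X : R * R -> R * R * R) :
  [\/ X = cuspidal_edge, X = swallowtail | X = cuspidal_cross_cap] ->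
  exists (tau : R) (D : set (paracomplex R))
         (g : paracomplex R -> paracomplex R)
         (f : paracomplex R -> R * R * R) (p : paracomplex R),
    tau != 0 /\
    [/\ domain D, simply_connected D, lorentz_harmonic D g & D p] /\
    minimal_surface tau D g f /\
    A_equivalent f p X (0, 0).
Proof.
case=> ->.
- apply: (@cusp_realization _ 2^-1 _ _ (@cuspidal_edge_ruled R)).
  rewrite (_ : _ - _ = - 2^-1); last by field.
  by rewrite normrN !ger0_norm; lra.
- exact: swallowtail_realization.
apply: (@cusp_realization _ 4^-1 _ _ (@cuspidal_cross_cap_ruled R)).
rewrite (_ : _ - _ = 0); last by field.
by rewrite normr0 ger0_norm; lra.
Qed.
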